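(* Assume that $c^n\in H^1(\Omega)$ satisfies $c_m\le c^n\le c_M$ almost everywhere in $\Omega$ and $\int_\Omega c^n\,dx=c_t$, where $0<c_m\le c_M$ and $\beta c_M\le\epsilon_0<1$, and that $\lambda>0$ satisfies $$\lambda\geq \frac{\epsilon_0}{(1-\epsilon_0)^2}+\left(\frac{\epsilon_0^2}{(1-\epsilon_0)^4}-2\ln(1-\epsilon_0)\frac{\epsilon_0}{(1-\epsilon_0)^2}\right)^{1/2}.$$ Let $c^{n+1}\in H^1(\Omega)$, together with the constant $\mu_e^{n+1}\in\mathbb R$, be the (weak) solution of the semi-implicit time-discrete scheme $$\frac{1}{\tau}(c^{n+1}-c^n)-\kappa\Delta c^{n+1}+\nu(c^n)c^{n+1}=s_r(c^n)+\mu_e^{n+1}\ \text{ in }\Omega,\qquad \int_\Omega c^{n+1}\,dx=c_t,\qquad \nabla c^{n+1}\cdot \mathbf n_{\partial\Omega}=0\ \text{ on }\partial\Omega ,$$ and suppose that $$\max_{c_m\le c\le c_M}\bigl(c_m\nu(c)-s_r(c)\bigr)\le \mu_e^{n+1}\le \min_{c_m\le c\le c_M}\bigl(c_M\nu(c)-s_r(c)\bigr).$$ Then, for any time step size $\tau>0$, $$F(c^{n+1})\le F(c^n),\qquad\text{where } F(c)=\int_\Omega f_b(c)\,dx+\frac{\kappa}{2}\int_\Omega|\nabla c|^2\,dx .$$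
   Context: $\Omega$ is a bounded, connected, smooth domain in $\mathbb R^d$ with outward unit normal $\mathbf n_{\partial\Omega}$. The constants $\kappa>0$, $c_t>0$ (total moles), $\vartheta_0\in\mathbb R$, $R>0$, $T>0$ are given. The Peng-Robinson parameters are $\alpha=\alpha(T)=0.45724\frac{R^2T_c^2}{P_c}[1+m(1-\sqrt{T/T_c})]^2$ and $\beta=0.07780\frac{RT_c}{P_c}>0$, where $T_c,P_c>0$ are the critical temperature and pressure and $m$ is a real number determined by the acentric factor $\omega$: $m=0.37464+1.54226\omega-0.26992\omega^2$ if $\omega\le0.49$, and $m=0.379642+1.485030\omega-0.164423\omega^2+0.016666\omega^3$ if $\omega>0.49$. The bulk Helmholtz free energy density is $$f_b(c)=c\,\vartheta_0+RT\,c\ln(c)-RT\,c\ln(1-\beta c)+\frac{\alpha c}{2\sqrt2\,\beta}\ln\Bigl(\frac{1+(1-\sqrt2)\beta c}{1+(1+\sqrt2)\beta c}\Bigr).$$ For $c\in[c_m,c_M]$ define $$G(c)=\sqrt{\lambda c-c\ln(1-\beta c)},\qquad \nu(c)=RT\Bigl(\frac1c+G'(c)^2\Bigr),$$ $$\mu_{\rm attraction}(c)=\frac{\alpha}{2\sqrt2\,\beta}\ln\Bigl(\frac{1+(1-\sqrt2)\beta c}{1+(1+\sqrt2)\beta c}\Bigr)-\frac{\alpha c}{1+2\beta c-(\beta c)^2},$$ $$s_r(c)=-\vartheta_0-RT\ln(c)+RT\bigl(G'(c)^2c-2G(c)G'(c)+\lambda\bigr)-\mu_{\rm attraction}(c).$$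 Weak solution means: $c^{n+1}\in H^1(\Omega)$ and $\mu_e^{n+1}\in\mathbb R$ (constant in space, part of the unknowns) satisfy $\int_\Omega c^{n+1}dx=c_t$ and, for all $w\in H^1(\Omega)$, $\frac1\tau(c^{n+1}-c^n,w)+\kappa(\nabla c^{n+1},\nabla w)+(\nu(c^n)c^{n+1},w)=(s_r(c^n)+\mu_e^{n+1},w)$, with $(\cdot,\cdot)$ the $L^2(\Omega)$ inner product. *)

(* Defs.v *)
From HB Require Import structures.
From mathcomp Require Import all_boot all_order all_algebra.
From mathcomp Require Import all_classical all_reals all_analysis.

Set Implicit Arguments.
Unset Strict Implicit.
Unset Printing Implicit Defensive.
Import Order.TTheory GRing.Theory Num.Theory.
Import numFieldNormedType.Exports.
Local Open Scope classical_set_scope.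
Local Open Scope ring_scope.

(* The sigma-algebra on row vectors generated by the coordinates; for vectors
   over R : realType this is the Borel sigma-algebra of R^n. *)
Section measurable_rV.
Context {d} {T : measurableType d}.
Variable n : nat.

Definition rV_coord (i : 'I_n) (v : 'rV[T]_n) : T := v ord0 i.

Let rV_set0 : g_sigma_preimage rV_coord set0.
Proof. exact: sigma_algebra0. Qed.

Let rV_setC A : g_sigma_preimage rV_coord A -> g_sigma_preimage rV_coord (~` A).
Proof. exact: sigma_algebraC. Qed.

Let rV_bigcup (F : _^nat) : (forall i, g_sigma_preimage rV_coord (F i)) ->
  g_sigma_preimage rV_coord (\bigcup_i (F i)).
Proof. exact: sigma_algebra_bigcup. Qed.

HB.instance Definition _ := @isMeasurable.Build (measure_tuple_display d)
  'rV[T]_n (g_sigma_preimage rV_coord) rV_set0 rV_setC rV_bigcup.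

End measurable_rV.

Lemma measurable_rV_coord d (T : measurableType d) n (i : 'I_n) :
  measurable_fun [set: 'rV[T]_n] (fun v => v ord0 i).
Proof.
move=> _ Y mY; rewrite setTI; apply: sub_sigma_algebra => /=.
rewrite -bigcup_seq/=; exists i => /=; first by rewrite mem_index_enum.
by exists Y => //; rewrite setTI.
Qed.

Lemma measurable_fun_rVP d1 d2 (T1 : measurableType d1)
    (T2 : measurableType d2) n (f : T1 -> 'rV[T2]_n) :
  (forall i, measurable_fun [set: T1] (fun x => f x ord0 i)) ->
  measurable_fun [set: T1] f.
Proof.
move=> mf.
suff sub : g_sigma_preimage (fun i => @rV_coord _ T2 n i \o f) `<=` measurable.
  rewrite g_sigma_preimage_comp in sub.
  by move=> _ A mA; apply: sub; exists A.
apply: smallest_sub; first exact: sigma_algebra_measurable.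
case: n => [|n] in f mf *; first by rewrite big_ord0.
rewrite -bigcup_mkord_ord; apply: bigcup_sub => i Ii.
by move=> A [B mB <-]; exact: mf.
Qed.

Section lebesgue_rV.
Context {R : realType}.

Definition rV_cons n (p : R * 'rV[R]_n) : 'rV[R]_n.+1 :=
  \row_(i < n.+1) if unlift ord0 i is Some j then p.2 ord0 j else p.1.

Definition rV_uncons n (v : 'rV[R]_n.+1) : R * 'rV[R]_n :=
  (v ord0 ord0, \row_(j < n) v ord0 (lift ord0 j)).

Lemma rV_consK n : cancel (@rV_cons n) (@rV_uncons n).
Proof.
move=> [x v]; rewrite /rV_uncons/= mxE unlift_none; congr pair.
by apply/rowP => j; rewrite !mxE liftK.
Qed.

Lemma measurable_rV_cons n : measurable_fun [set: R * 'rV[R]_n] (@rV_cons n).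
Proof.
apply: measurable_fun_rVP => i; case: (unliftP ord0 i) => [j ->|->].
- rewrite (_ : (fun _ => _) = (fun v : 'rV[R]_n => v ord0 j) \o snd).
    by apply: measurableT_comp; [exact: measurable_rV_coord|].
  by apply/funext => p /=; rewrite mxE liftK.
- rewrite (_ : (fun _ => _) = fst)//.
  by apply/funext => p /=; rewrite mxE unlift_none.
Qed.

Lemma measurable_rV_uncons n :
  measurable_fun [set: 'rV[R]_n.+1] (@rV_uncons n).
Proof.
apply/measurable_fun_pairP; split; first exact: measurable_rV_coord.
apply: measurable_fun_rVP => i.
rewrite (_ : (fun _ => _) = fun v : 'rV[R]_n.+1 => v ord0 (lift ord0 i)).
  exact: measurable_rV_coord.
by apply/funext => p /=; rewrite mxE.
Qed.

Section step.
Variables (n : nat) (mu : {sigma_finite_measure set 'rV[R]_n -> \bar R}).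

Definition lebesgue_rVS : set 'rV[R]_n.+1 -> \bar R :=
  pushforward (@lebesgue_measure R \x mu)%E (@rV_cons n).

Let rVS0 : lebesgue_rVS set0 = 0%E.
Proof. by rewrite /lebesgue_rVS /pushforward preimage_set0 measure0. Qed.

Let rVS_ge0 A : (0 <= lebesgue_rVS A)%E.
Proof.
by rewrite /lebesgue_rVS /pushforward; apply: integral_ge0 => *; exact: measure_ge0.
Qed.

Let rVS_sigma_additive : semi_sigma_additive lebesgue_rVS.
Proof.
move=> F mF tF mUF; rewrite /lebesgue_rVS /pushforward preimage_bigcup.
apply: measure_semi_sigma_additive.
- move=> n'; rewrite -[X in measurable X]setTI.
  exact: (measurable_rV_cons measurableT (mF n')).
- apply/trivIsetP => /= i j _ _ ij; rewrite -preimage_setI.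
  by move/trivIsetP : tF => /(_ _ _ _ _ ij) ->//; rewrite preimage_set0.
- rewrite -preimage_bigcup -[X in measurable X]setTI.
  exact: (measurable_rV_cons measurableT mUF).
Qed.

HB.instance Definition _ := isMeasure.Build _ _ _ lebesgue_rVS
  rVS0 rVS_ge0 rVS_sigma_additive.

Let sigma_finite_rVS : sigma_finite setT lebesgue_rVS.
Proof.
have /sigma_finiteP[F [TF ndF Foo]] := sigma_finiteT (@lebesgue_measure R).
have /sigma_finiteP[G [TG ndG Goo]] := sigma_finiteT mu.
exists (fun k => @rV_uncons n @^-1` (F k `*` G k)).
  apply/esym/seteqP; split=> // v _.
  have [k _ Fk] : (\bigcup_k F k) (v ord0 ord0) by rewrite -TF.
  have [l _ Gl] : (\bigcup_k G k) (rV_uncons v).2 by rewrite -TG.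
  exists (maxn k l) => //; split => /=.
  - by move: Fk; exact/subsetPset/ndF/leq_maxl.
  - by move: Gl; exact/subsetPset/ndG/leq_maxr.
move=> k; have [mF Fk] := Foo k; have [mG Gk] := Goo k; split.
  rewrite -[X in measurable X]setTI.
  exact: (measurable_rV_uncons measurableT (measurableX mF mG)).
rewrite /lebesgue_rVS /pushforward -comp_preimage.
rewrite (_ : _ \o _ = id); last by apply/funext => p; exact: rV_consK.
rewrite preimage_id product_measure1E// lte_mul_pinfty//.
by rewrite ge0_fin_numE.
Qed.

HB.instance Definition _ :=
  Measure_isSigmaFinite.Build _ _ _ lebesgue_rVS sigma_finite_rVS.

End step.

(* Lebesgue measure on R^n: the n-fold product of the Lebesgue measure on R. *)
Fixpoint lebesgue_rV (n : nat) : {sigma_finite_measure set 'rV[R]_n -> \bar R} :=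
  if n is m.+1 then lebesgue_rVS (lebesgue_rV m) else dirac (0 : 'rV[R]_0).

End lebesgue_rV.

Lemma lebesgue_rV_box (R : realType) n (A : 'I_n -> set (measurableTypeR R)) :
  (forall i, measurable (A i)) ->
  lebesgue_rV n [set v : 'rV[R]_n | forall i, A i (v ord0 i)] =
  (\prod_(i < n) lebesgue_measure (A i))%E.
Proof.
elim: n A => [|n IH] A mA.
  by rewrite big_ord0/= diracE mem_set// => -[].
rewrite big_ord_recl/= /lebesgue_rVS /pushforward.
rewrite (_ : _ @^-1` _ = A ord0 `*`
    [set v : 'rV[R]_n | forall i, A (lift ord0 i) (v ord0 i)]).
  rewrite product_measure1E//.
    congr (_ * _)%E; exact: IH (fun i => A (lift ord0 i)) (fun i => mA _).
  rewrite (_ : [set _ | _] = \bigcap_(i in [set: 'I_n])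
      (fun v : 'rV[R]_n => v ord0 i) @^-1` A (lift ord0 i)).
    apply: fin_bigcap_measurable => // i _; rewrite -[X in measurable X]setTI.
    exact: (measurable_rV_coord i measurableT (mA (lift ord0 i))).
  by apply/seteqP; split=> [v Av i _|v Av i]; exact: Av.
apply/seteqP; split=> -[x v] /=.
- move=> H; split=> [|i].
    by have := H ord0; rewrite mxE unlift_none.
  by have := H (lift ord0 i); rewrite mxE liftK.
- move=> [Ax Av] i; rewrite mxE; case: (unliftP ord0 i) => [j ->|->].
    by rewrite ?liftK; exact: Av.
  by rewrite ?unlift_none.
Qed.

Section smooth.
Context {R : realType} {d : nat}.
Implicit Types (f phi : 'rV[R]_d -> R) (Omega : set 'rV[R]_d).

Definition partial (i : 'I_d) f : 'rV[R]_d -> R :=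
  fun x => 'D_(delta_mx ord0 i) f x.

(* f is C^oo: all its iterated partial derivatives exist and are (Frechet)
   differentiable, hence continuous. *)
Definition smooth f :=
  forall (s : seq 'I_d) (x : 'rV[R]_d), differentiable (foldr partial f s) x.

Definition test_function Omega phi :=
  [/\ smooth phi, compact (closure [set x | phi x != 0]) &
      closure [set x | phi x != 0] `<=` Omega].

(* Near each of its boundary points, Omega is {rho < 0} for some smooth rho
   whose gradient does not vanish at that point: the boundary is C^oo and Omega
   lies locally on one side of it. *)
Definition smooth_boundary Omega :=
  forall x, (closure Omega `\` Omega) x ->
    exists rho, [/\ smooth rho, exists i, partial i rho x != 0 &
      \forall y \near x, Omega y <-> rho y < 0].

Definition smooth_bounded_domain Omega :=
  [/\ Omega !=set0, open Omega, connected Omega, bounded_set Omega &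
      smooth_boundary Omega].

End smooth.

Section H1.
Context {R : realType} {d : nat}.
Local Notation leb := (lebesgue_rV (R := R) d).
Implicit Types (u v : 'rV[R]_d -> R) (Omega : set 'rV[R]_d).

Definition inner_L2 Omega u v : R := \int[leb]_(x in Omega) (u x * v x).

Definition in_L2 Omega u :=
  measurable_fun Omega u /\
  leb.-integrable Omega (EFin \o (fun x => u x ^+ 2)).

Definition is_weak_partial Omega (i : 'I_d) u v :=
  forall phi, test_function Omega phi ->
    inner_L2 Omega u (partial i phi) = - inner_L2 Omega v phi.

(* An element of H^1(Omega): a representative of the class (its values outside
   Omega are irrelevant) with a representative of its weak gradient, which is
   unique almost everywhere. *)
Record H1 Omega := MkH1 {
  H1_val :> 'rV[R]_d -> R;
  H1_grad : 'I_d -> 'rV[R]_d -> R;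
  H1_val_L2 : in_L2 Omega H1_val;
  H1_grad_L2 : forall i, in_L2 Omega (H1_grad i);
  H1_gradP : forall i, is_weak_partial Omega i H1_val (H1_grad i)
}.

Definition inner_grad Omega (u v : H1 Omega) : R :=
  \int[leb]_(x in Omega) \sum_(i < d) (H1_grad u i x * H1_grad v i x).

End H1.

Section peng_robinson.
Context {R : realType}.

(* dec a b c is the decimal number a.bbbccc *)
Definition dec (a b c : nat) : R := a%:R + b%:R / 10 ^+ 3 + c%:R / 10 ^+ 6.

Definition pr_m (omega : R) : R :=
  if omega <= dec 0 490 0 then
    dec 0 374 640 + dec 1 542 260 * omega - dec 0 269 920 * omega ^+ 2
  else
    dec 0 379 642 + dec 1 485 30 * omega - dec 0 164 423 * omega ^+ 2
      + dec 0 16 666 * omega ^+ 3.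

(* Rg is the gas constant, Te the temperature, Tc and Pc the critical
   temperature and pressure, omega the acentric factor. *)
Definition pr_alpha (Rg Te Tc Pc omega : R) : R :=
  dec 0 457 240 * (Rg ^+ 2 * Tc ^+ 2 / Pc)
    * (1 + pr_m omega * (1 - Num.sqrt (Te / Tc))) ^+ 2.

Definition pr_beta (Rg Tc Pc : R) : R := dec 0 77 800 * (Rg * Tc / Pc).

Variables (theta0 Rg Te alpha beta lambda : R).

Definition pr_log (c : R) : R :=
  ln ((1 + (1 - Num.sqrt 2) * beta * c) / (1 + (1 + Num.sqrt 2) * beta * c)).

Definition f_b (c : R) : R :=
  c * theta0 + Rg * Te * c * ln c - Rg * Te * c * ln (1 - beta * c)
    + alpha * c / (2 * Num.sqrt 2 * beta) * pr_log c.

Definition G_fun (c : R) : R := Num.sqrt (lambda * c - c * ln (1 - beta * c)).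

Definition nu (c : R) : R := Rg * Te * (c^-1 + derive1 G_fun c ^+ 2).

Definition mu_attraction (c : R) : R :=
  alpha / (2 * Num.sqrt 2 * beta) * pr_log c
    - alpha * c / (1 + 2 * beta * c - (beta * c) ^+ 2).

Definition s_r (c : R) : R :=
  - theta0 - Rg * Te * ln c
    + Rg * Te * (derive1 G_fun c ^+ 2 * c - 2 * G_fun c * derive1 G_fun c + lambda)
    - mu_attraction c.

End peng_robinson.

Section scheme.
Context {R : realType} {d : nat} {Omega : set 'rV[R]_d}.
Local Notation leb := (lebesgue_rV (R := R) d).

Definition free_energy (kappa : R) (f : R -> R) (c : H1 Omega) : R :=
  \int[leb]_(x in Omega) f (c x) + kappa / 2 * inner_grad c c.

Definition weak_solution (tau kappa ct : R) (nu s : R -> R)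
    (c0 c1 : H1 Omega) (mu : R) :=
  \int[leb]_(x in Omega) c1 x = ct /\
  forall w : H1 Omega,
    tau^-1 * inner_L2 Omega (fun x => c1 x - c0 x) w
      + kappa * inner_grad c1 w
      + inner_L2 Omega (fun x => nu (c0 x) * c1 x) w
    = inner_L2 Omega (fun x => s (c0 x) + mu) w.

End scheme.

(* Main.v *)
(** The scheme is tested with [w = c1 - c0].  Constants drop out because the
    mass is conserved, and the claim reduces to the pointwise inequality
    [f_b b - f_b a <= (nu a * b - s_r a) * (b - a)] for [a, b] in [[cm, cM]]:
    the attraction term is concave, [b ln (b / a) <= b (b / a - 1)], and
    [- c ln (1 - beta c) = G ^ 2 - lambda c] where [G] is concave thanks to the
    lower bound on [lambda].

    That inequality needs [cm <= c1 <= cM] almost everywhere, which is the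
    maximum principle: test with [phi o c1], [phi] nondecreasing and vanishing
    on one side of the bound.  The chain rule in H^1 that this uses is proved
    without mollification.  By the fundamental lemma of the calculus of
    variations, a weak partial derivative [g] of [u] in the direction [e]
    satisfies [u (x + h e) - u x = int_0^h g (x + t e) dt] for almost every
    [x]; hence, up to an error O(h^2), the discrete integration by parts
    [int phi(u) (psi (. - h e) - psi) = int (phi(u (. + h e)) - phi(u)) psi]
    is the weak chain rule multiplied by [h]. *)

Require Import Defs.
From mathcomp Require Import all_boot all_order all_algebra.
From mathcomp Require Import all_classical all_reals all_analysis.
From mathcomp Require Import measurable_realfun ring lra.
Set Implicit Arguments.
Unset Strict Implicit.
Unset Printing Implicit Defensive.
Import Order.TTheory GRing.Theory Num.Theory.
Import numFieldNormedType.Exports.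
Local Open Scope classical_set_scope.
Local Open Scope ring_scope.

(** * Integrals and null sets *)

(** The error in the chain rule is O(h^2) although [g] is merely in L^2. By Cauchy-Schwarz the
    square of an increment of [u] is at most [h int_0^h g^2 (x + t e) dt], and integration over [x]
    turns this into [h^2 int g^2]; a quadratic Taylor remainder of [phi] therefore costs O(h^2). The
    same bound makes [t |-> int m g (. + t e)], with [m = phi'(u) psi], Lipschitz at 0 once the
    translation is moved from [g] to [m]. Both uses ask [phi] for a bounded Lipschitz derivative, so
    the positive part must be smoothed. Translations live on the whole space, hence functions on
    [Om] are extended by zero; the increment formula holds only where the segment stays in [Om], so
    it is used near the support of the test function. The coefficients are controlled on [[cm, cM]],
    which [c0] and [c1] respect only almost everywhere. This explains the null-set lemmas for
    arbitrary functions and the restriction of the coefficients to the segment. The bound on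
    [lambda] enters through [2 y / (1 - y)^2 <= lambda] for [y = beta c]; it yields
    [2 g g'' <= g'^2] for [g = G^2], which is the concavity of [G]. *)

Section null_sets.
Context d (T : measurableType d) (R : realType).
Variable mu : {measure set T -> \bar R}.
Import HBNNSimple.

(* [integral] is defined for arbitrary functions, as a supremum over simple
   functions, and this holds without measurability of [f]. *)
Let ge0_integral_setD_null (D N : set T) (f : T -> \bar R) :
  measurable N -> mu N = 0%E ->
  (forall x, D x -> 0 <= f x)%E ->
  (\int[mu]_(x in D) f x = \int[mu]_(x in D `\` N) f x)%E.
Proof.
move=> mN N0 f0.
have f0' x : (D `\` N) x -> (0 <= f x)%E by move=> [Dx _]; exact: f0.
rewrite ge0_integralE// [RHS]ge0_integralE//.
apply/eqP; rewrite eq_le; apply/andP; split; last first.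
  apply: le_ereal_sup => /= _ [h hf <-]; exists h => //= x.
  apply: (le_trans (hf x)); rewrite !patchE.
  case: ifPn => [|_].
    by rewrite in_setD => /andP[-> _].
  by case: ifPn => // /set_mem/f0.
apply: ge_ereal_sup => /= _ [h hf <-].
have mNC := measurableC mN.
(* The simple function [h] cut off to 0 on [N]: its integral is unchanged because [N] is null, and
   it is an admissible competitor for the function restricted to [D] minus [N]. *)
pose h' : {nnsfun T >-> R} := proj_nnsfun h mNC.
have -> : sintegral mu h = sintegral mu h'.
  have sN (k : {nnsfun T >-> R}) :
      (sintegral mu k = \int[mu]_(x in setT `\` N) (k x)%:E)%E.
    rewrite -integralT_nnsfun; apply: ge0_negligible_integral => //.
    - exact: measurableT_comp.
    - by move=> x _; rewrite lee_fin fun_ge0.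
  rewrite !sN.
  apply: eq_integral => x; rewrite inE /= => -[_ Nx].
  by rewrite /h' /= mindicE mem_set// mulr1.
apply: ereal_sup_ubound; exists h' => //= x.
rewrite /= mindicE; have [xN|/negP xN] := boolP (x \in ~` N).
  rewrite mulr1; apply: (le_trans (hf x)); rewrite !patchE in_setD.
  by rewrite -in_setC xN andbT.
rewrite mulr0 patchE; case: ifPn => // /set_mem; exact: f0'.
Qed.

Lemma integral_setD_null (D N : set T) (f : T -> \bar R) :
  measurable N -> mu N = 0%E ->
  (\int[mu]_(x in D) f x = \int[mu]_(x in D `\` N) f x)%E.
Proof.
move=> mN N0; rewrite integralE [RHS]integralE.
by congr (_ - _)%E; exact: ge0_integral_setD_null.
Qed.

(** Deleting the exceptional null set from both domains leaves functions that agree everywhere. The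
    generality serves compositions such as [nu (c0 x)], where [nu] is controlled only on
    [[cm, cM]]. *)
Lemma ae_eq_integral_nomeas (D : set T) (f g : T -> \bar R) :
  {ae mu, forall x, D x -> f x = g x} ->
  (\int[mu]_(x in D) f x = \int[mu]_(x in D) g x)%E.
Proof.
move=> [N [mN N0 fgN]].
rewrite (integral_setD_null _ _ mN N0) [in RHS](integral_setD_null _ _ mN N0).
apply: eq_integral => x; rewrite inE => -[Dx Nx].
by apply: contrapT => fgx; apply: Nx; apply: fgN => /(_ Dx).
Qed.

Lemma ae_eq_Rintegral (D : set T) (f g : T -> R) :
  {ae mu, forall x, D x -> f x = g x} ->
  \int[mu]_(x in D) f x = \int[mu]_(x in D) g x.
Proof.
move=> fg; congr fine; apply: ae_eq_integral_nomeas.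
by apply: filterS fg => x + Dx => /(_ Dx) ->.
Qed.

Lemma ae_le_Rintegral (D : set T) (f g : T -> R) : measurable D ->
  mu.-integrable D (EFin \o f) -> mu.-integrable D (EFin \o g) ->
  {ae mu, forall x, D x -> f x <= g x} ->
  \int[mu]_(x in D) f x <= \int[mu]_(x in D) g x.
Proof.
move=> mD fi gi fg.
(* Replacing [g] by the maximum of [f] and [g] changes nothing almost everywhere and makes the
   comparison hold at every point. *)
rewrite (@ae_eq_Rintegral D g (fun x => Num.max (f x) (g x))); last first.
  by apply: filterS fg => x + Dx => /(_ Dx) fgx; rewrite max_r.
apply: le_Rintegral => //; last by move=> x _; rewrite le_max lexx.
have [mf _] := integrableP _ _ _ fi; have [mg _] := integrableP _ _ _ gi.
apply: (le_integrable mD _ _ (integrableD mD (integrable_norm fi)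
    (integrable_norm gi))).
  by apply/measurable_EFinP; apply: measurable_maxr; exact/measurable_EFinP.
move=> x _ /=; rewrite lee_fin [leRHS]ger0_norm//.
by rewrite /Num.max; case: ifP => _; rewrite ?lerDl ?lerDr.
Qed.

Lemma ae_le_integrable (D : set T) (f g : T -> R) : measurable D ->
  measurable_fun D f -> mu.-integrable D (EFin \o g) ->
  {ae mu, forall x, D x -> `|f x| <= g x} ->
  mu.-integrable D (EFin \o f).
Proof.
move=> mD mf gi fg; have [mg goo] := integrableP _ _ _ gi.
apply/integrableP; split; first exact/measurable_EFinP.
apply: le_lt_trans goo; apply: ae_ge0_le_integral => //.
- by apply: measurableT_comp => //; exact/measurable_EFinP.
- exact: measurableT_comp.
- apply: filterS fg => x + Dx => /(_ Dx) fgx /=.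
  by rewrite lee_fin (le_trans fgx)// ler_norm.
Qed.

Lemma ae_normr_Rintegral (D : set T) (f g : T -> R) : measurable D ->
  mu.-integrable D (EFin \o f) -> mu.-integrable D (EFin \o g) ->
  {ae mu, forall x, D x -> `|f x| <= g x} ->
  `|\int[mu]_(x in D) f x| <= \int[mu]_(x in D) g x.
Proof.
move=> mD fi gi fg; apply: le_trans (le_normr_Rintegral mD fi) _.
by apply: ae_le_Rintegral => //; exact: integrable_norm.
Qed.

Lemma Rintegral_eq0_ae (D : set T) (f : T -> R) : measurable D ->
  mu.-integrable D (EFin \o f) ->
  {ae mu, forall x, D x -> 0 <= f x} ->
  \int[mu]_(x in D) f x <= 0 -> {ae mu, forall x, D x -> f x = 0}.
Proof.
move=> mD fi f0 fle0.
have /measurable_EFinP mf := measurable_int _ fi.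
have : (\int[mu]_(x in D) `|(f x)%:E| = 0)%E.
  rewrite -[LHS]fineK; last exact/integrable_fin_num/integrable_abse.
  congr EFin; apply/eqP; rewrite eq_le fine_ge0 ?integral_ge0// andbT.
  apply: le_trans fle0; rewrite le_eqVlt; apply/orP; left; apply/eqP.
  rewrite -[LHS]/(Rintegral mu D (fun x => `|f x|)).
  apply: ae_eq_Rintegral; apply: filterS f0 => x + Dx => /(_ Dx) fx.
  by rewrite ger0_norm.
move/(ae_eq_integral_abs mu mD (measurable_int _ fi)).
by apply: filterS => x /= + Dx => /(_ Dx) [].
Qed.

End null_sets.

(** * Lebesgue measure on row vectors *)

Section rV_topology_measure.
Context {R : realType} {d : nat}.
Local Notation V := 'rV[R]_d.

(** The norm of row vectors is the maximum norm, so balls are open boxes. Positivity of [e] takes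
    care of the empty maximum when [d = 0]. *)
Lemma rV_normP (v : V) (e : R) : 0 < e ->
  (`|v| < e) <-> (forall i, `|v ord0 i| < e).
Proof.
move=> e0; rewrite [`|v|]/Num.norm/= mx_normrE; split.
  move=> /bigmax_ltP[_ H] i; exact: (H (ord0, i)).
by move=> H; apply/bigmax_ltP; split => // -[i j] _ /=; rewrite (ord1 i).
Qed.

Lemma rV_norm_coord (v : V) i : `|v ord0 i| <= `|v|.
Proof.
rewrite [leRHS]/Num.norm/= mx_normrE.
exact: (le_bigmax _ (fun ij : 'I_1 * 'I_d => `|v ij.1 ij.2|) (ord0, i)).
Qed.

Lemma measurable_rV_cst_coord (i : 'I_d) (A : set (measurableTypeR R)) : measurable A ->
  measurable [set v : V | A (v ord0 i)].
Proof.
move=> mA; rewrite -[X in measurable X]setTI.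
exact: (@measurable_rV_coord _ (measurableTypeR R) d i measurableT A mA).
Qed.

Lemma measurable_rV_box (A : 'I_d -> set (measurableTypeR R)) :
  (forall i, measurable (A i)) -> measurable [set v : V | forall i, A i (v ord0 i)].
Proof.
move=> mA; rewrite [X in measurable X](_ : _ =
    \bigcap_(i in [set: 'I_d]) [set v : V | A i (v ord0 i)]); last first.
  by apply/seteqP; split=> v Av i; [move=> _|]; exact: Av.
by apply: fin_bigcap_measurable => // i _; exact: measurable_rV_cst_coord.
Qed.

Lemma measurable_rV_ball (v : V) (e : R) : 0 < e -> measurable (ball v e).
Proof.
move=> e0; rewrite [X in measurable X](_ : _ =
    [set w : V | forall i, `]v ord0 i - e, v ord0 i + e[%classic (w ord0 i)]).
  by apply: (@measurable_rV_box (fun i => `]v ord0 i - e, v ord0 i + e[%classic)).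
apply/seteqP; split => w; rewrite -ball_normE /ball_/=.
  move=> /rV_normP-/(_ e0) H i; have := H i; rewrite !mxE in_itv/=.
  by rewrite distrC ltr_distl.
move=> H; apply/rV_normP => // i; have := H i; rewrite !mxE in_itv/=.
by rewrite distrC ltr_distl.
Qed.

(** The sigma-algebra is generated by coordinates, so an open set is measurable only through a
    countable cover. The doubled radius leaves room for the closed box of half size inside [A],
    which the fundamental lemma of the calculus of variations needs later. *)
Lemma open_rV_bigcup_ball (A : set V) : open A ->
  A = \bigcup_(p in [set p : 'rV[rat]_d * nat |
        ball (map_mx ratr p.1 : V) (2 * p.2.+1%:R^-1) `<=` A])
      ball (map_mx ratr p.1 : V) p.2.+1%:R^-1.
Proof.
move=> oA; apply/seteqP; split => [x Ax|x [p pA]]; last first.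
  move=> xp; apply: pA; apply: le_ball xp.
  by rewrite ler_peMl ?invr_ge0// ler1n.
have /nbhs_ballP[e /= e0 eA] := open_nbhs_nbhs (conj oA Ax).
(* With radius below [e / 3], a point of the doubled ball is within [2 e / 3] of the rational
   centre, which is itself within [e / 3] of [x]. *)
have e30 : 0 < e / 3 by rewrite divr_gt0.
have [n _ /(_ n (leqnn n))/= ne] := near_infty_natSinv_lt (PosNum e30).
have n0 : 0 < n.+1%:R^-1 :> R by rewrite invr_gt0.
have q i : {q : rat | x ord0 i - n.+1%:R^-1 < ratr q < x ord0 i + n.+1%:R^-1}.
  apply: cid; have [|q] := @rat_in_itvoo _ (x ord0 i - n.+1%:R^-1) (x ord0 i + n.+1%:R^-1).
    by rewrite ltrBlDr -addrA ltrDl addr_gt0.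
  by rewrite in_itv/= => ?; exists q.
exists (\row_i sval (q i), n) => /=; last first.
  rewrite -ball_normE /ball_/=; apply/rV_normP => // i; rewrite !mxE.
  by have := svalP (q i); rewrite distrC ltr_distlC.
have n20 : 0 < 2 * n.+1%:R^-1 :> R by rewrite mulr_gt0.
move=> y; rewrite -ball_normE /ball_/= => /rV_normP-/(_ n20) Hy; apply: eA.
rewrite -ball_normE /ball_/=; apply/rV_normP => // i; rewrite !mxE.
have := Hy i; rewrite !mxE => yi.
have /= := svalP (q i); rewrite -ltr_distlC => qi.
rewrite (le_lt_trans (ler_distD (ratr (sval (q i))) _ _))//.
rewrite (_ : e = e / 3 + 2 * (e / 3)); last by field.
by rewrite ltrD// ?(lt_trans qi)// (lt_trans yi)// ltr_pM2l.
Qed.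

Lemma open_measurable_rV (A : set V) : open A -> measurable A.
Proof.
move=> /open_rV_bigcup_ball ->; rewrite bigcup_mkcond.
apply: countable_bigcupT_measurable => [|p]; first exact: countableP.
by case: ifPn => // _; apply: measurable_rV_ball; rewrite invr_gt0.
Qed.

Lemma continuous_measurable_rV (f : V -> R) : continuous f ->
  measurable_fun [set: V] f.
Proof.
move=> cf; apply: (measurability _ (RGenOpens.measurableE R)) => //.
move=> _ [_ [a [b ->] <-]]; rewrite setTI; apply: open_measurable_rV.
by apply: open_comp => // x _; exact: cf.
Qed.

Lemma lebesgue_rV_bounded (A : set V) : measurable A -> bounded_set A ->
  (lebesgue_rV d A < +oo)%E.
Proof.
move=> mA [M [_ HM]].
pose B := [set v : V | forall i, `[- (M + 1), M + 1]%classic (v ord0 i)].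
have mB : measurable B.
  by apply: (@measurable_rV_box (fun=> `[- (M + 1), M + 1]%classic)).
apply: (@le_lt_trans _ _ (lebesgue_rV d B)).
  apply: le_measure; rewrite ?inE// => v Av i /=.
  rewrite in_itv/= -ler_norml (le_trans (rV_norm_coord v i))//.
  by apply: HM => //; rewrite ltrDl.
rewrite (@lebesgue_rV_box _ _ (fun=> `[- (M + 1), M + 1]%classic))//.
rewrite big_const_ord; elim: d => [|n ih]/=; first by rewrite ltry.
rewrite lte_mul_pinfty// lebesgue_measure_itv/=; last by case: ifP => // _; rewrite ltry.
Qed.

End rV_topology_measure.

(** * Translation invariance of Lebesgue measure *)

Lemma lebesgue_measure_translate {R : realType} (a : R)
    (A : set (measurableTypeR R)) : measurable A ->
  pushforward lebesgue_measure
    ((fun x : R => x + a) : measurableTypeR R -> measurableTypeR R) A =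
  lebesgue_measure A.
Proof.
move=> mA; apply/esym/lebesgue_measure_unique => //=; first exact: measurable_funD.
move=> ? _ [[x y] _ <-]/=.
rewrite /pushforward (_ : _ @^-1` _ = `]x - a, y - a]%classic).
  rewrite !lebesgue_measure_itv/=.
  rewrite !lte_fin ltrD2r; case: ifP => // _.
  by rewrite -!EFinB; congr EFin; ring.
by apply/seteqP; split => z /=; rewrite !in_itv/= ltrBlDr lerBrDr.
Qed.

Section rV_translation.
Context {R : realType} {d : nat}.
Local Notation V := 'rV[R]_d.
Implicit Types (H : set (set V)) (f : V -> R).

(** Used for two generating pi-systems: rectangles, for the uniqueness of measures, and orthants,
    for a Dynkin induction. *)
Lemma rV_sigma_generated H : H `<=` measurable ->
  (forall (i : 'I_d) (A : set (measurableTypeR R)), measurable A ->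
     <<s H >> [set v : V | A (v ord0 i)]) ->
  (measurable : set (set V)) = <<s H >>.
Proof.
move=> mH sH; apply/seteqP; split; last first.
  by apply: smallest_sub => //; exact: sigma_algebra_measurable.
apply: smallest_sub; first exact: smallest_sigma_algebra.
move=> A; rewrite /= -bigcup_seq => -[i _ [B mB <-]].
by rewrite setTI; exact: sH.
Qed.

Definition rV_rectangles : set (set V) := [set A : set V |
  exists2 B : 'I_d -> set (measurableTypeR R), (forall i, measurable (B i)) &
    A = [set v : V | forall i, B i (v ord0 i)]].

Lemma rV_rectangles_sigma : (measurable : set (set V)) = <<s rV_rectangles >>.
Proof.
apply: rV_sigma_generated.
  by move=> _ [B mB ->]; exact: measurable_rV_box.
move=> i A mA; apply: sub_sigma_algebra.
exists (fun j => if j == i then A else setT).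
  by move=> j; case: ifP.
apply/seteqP; split => v /=; first by move=> Av j; case: eqP => [->|].
by move/(_ i); rewrite eqxx.
Qed.

Lemma measurable_fun_rV_translate (v : V) :
  measurable_fun [set: V] (fun x : V => x + v).
Proof.
apply: measurable_fun_rVP => i.
rewrite [X in measurable_fun _ X](_ : _ = (fun x : V => x ord0 i + v ord0 i)).
  by apply: measurable_funD => //; exact: measurable_rV_coord.
by apply/funext => x; rewrite mxE.
Qed.

Let lebesgue_rV_translate_rectangle (v : V) (A : set V) : rV_rectangles A ->
  pushforward (lebesgue_rV d) (fun x : V => x + v) A = lebesgue_rV d A.
Proof.
move=> [B mB ->]; rewrite lebesgue_rV_box// /pushforward.
have mBv i : measurable ((fun x : R => x + v ord0 i) @^-1` B i).
  have ma : measurable_fun [set: measurableTypeR R]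
      ((fun x : R => x + v ord0 i) : _ -> measurableTypeR R).
    exact: measurable_funD.
  by rewrite -[X in measurable X]setTI; exact: ma.
rewrite [X in lebesgue_rV d X](_ : _ = [set w : V |
    forall i, ((fun x : R => x + v ord0 i) @^-1` B i) (w ord0 i)]).
  rewrite (lebesgue_rV_box mBv); apply: eq_bigr => i _.
  by rewrite -[RHS](lebesgue_measure_translate (v ord0 i)).
by apply/seteqP; split => w /= Bw i; have := Bw i; rewrite mxE.
Qed.

(** Both measures agree on rectangles by the one-dimensional case in each factor; rectangles form a
    pi-system and the cubes of side [2 n], of finite measure, exhaust the space. *)
Lemma lebesgue_rV_translate (v : V) (A : set V) : measurable A ->
  pushforward (lebesgue_rV d) (fun x : V => x + v) A = lebesgue_rV d A.
Proof.
move=> mA; apply: (measure_unique rV_rectangles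
  (fun n => [set v : V | forall i, `]- n%:R, n%:R[%classic (v ord0 i)])).
- exact: rV_rectangles_sigma.
- move=> _ _ [B mB ->] [C mC ->]; exists (fun i => B i `&` C i).
    by move=> i; exact: measurableI.
  apply/seteqP; split => w /=; first by move=> [Bw Cw] i.
  by move=> BC; split=> i; case: (BC i).
- by move=> n; exists (fun=> `]- n%:R, n%:R[%classic).
- apply/seteqP; split => // w _; exists (Num.bound `|w|) => // i /=.
  rewrite in_itv/= -ltr_norml (le_lt_trans (rV_norm_coord w i))//.
  exact: archi_boundP.
- exact: measurable_fun_rV_translate.
- by move=> mv B; exact: lebesgue_rV_translate_rectangle.
- move=> mv k; rewrite [ltLHS]lebesgue_rV_translate_rectangle; last first.
    by exists (fun=> `]- k%:R, k%:R[%classic).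
  apply: lebesgue_rV_bounded.
    by apply: (@measurable_rV_box _ _ (fun=> `]- k%:R, k%:R[%classic)).
  exists k%:R; split=> // M kM w /= wk.
  have [d0|d0] := pselect (exists i : 'I_d, true); last first.
    rewrite (_ : w = 0) ?normr0 ?(le_trans _ (ltW kM))//.
    by apply/rowP => i; exfalso; apply: d0; exists i.
  have M0 : 0 < M by rewrite (le_lt_trans _ kM).
  apply/ltW/rV_normP => // i; have := wk i; rewrite in_itv/= -ltr_norml.
  by move/lt_trans; apply.
- by [].
Qed.

End rV_translation.

Section rV_translate_integral.
Context {R : realType} {d : nat}.
Local Notation V := 'rV[R]_d.
Local Notation mu := (lebesgue_rV (R := R) d).

Lemma ge0_integral_translate (v : V) (f : V -> \bar R) :
  measurable_fun [set: V] f -> (forall x, 0 <= f x)%E ->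
  integral mu setT (fun x : V => f (x + v)) = integral mu setT f.
Proof.
move=> mf f0; have mv := @measurable_fun_rV_translate R d v.
rewrite -[RHS](@eq_measure_integral _ _ _ _ mu (pushforward mu (fun x : V => x + v))) => [|A mA _].
  by rewrite ge0_integral_pushforward.
exact: lebesgue_rV_translate.
Qed.

Lemma integrable_translate (v : V) (f : V -> R) :
  mu.-integrable setT (EFin \o f) ->
  mu.-integrable setT (EFin \o (fun x : V => f (x + v))).
Proof.
have mv := @measurable_fun_rV_translate R d v.
move=> /integrableP[mf foo]; apply/integrableP; split.
  exact: (measurableT_comp mf mv).
rewrite /= (@ge0_integral_translate v (fun x : V => `|(f x)%:E|)%E)//.
exact: measurableT_comp.
Qed.

Lemma Rintegral_translate (v : V) (f : V -> R) :
  mu.-integrable setT (EFin \o f) ->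
  Rintegral mu setT (fun x : V => f (x + v)) = Rintegral mu setT f.
Proof.
have mv := @measurable_fun_rV_translate R d v.
move=> fi; have mf := measurable_int _ fi; rewrite /Rintegral; congr fine.
rewrite -[RHS](@eq_measure_integral _ _ _ _ mu (pushforward mu (fun x : V => x + v))) => [|A mA _].
  rewrite integral_pushforward//. exact: (integrable_translate v fi).
exact: lebesgue_rV_translate.
Qed.

End rV_translate_integral.

(** * Smooth bump functions *)

Section flat_function.
Context {R : realType}.
Implicit Types (s x : R) (m k : nat).

(** The case [m = 0] is the classical smooth function that is flat at 0. The power is carried along
    so that a derivative is a combination of members of the same family. *)
Definition flat m s : R := if 0 < s then s^-1 ^+ m * expR (- s^-1) else 0.

Lemma flat_le0 m s : s <= 0 -> flat m s = 0.
Proof. by move=> s0; rewrite /flat ltNge s0. Qed.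

Lemma flat_gt0 m s : 0 < s -> 0 < flat m s.
Proof. by move=> s0; rewrite /flat s0 mulr_gt0 ?expR_gt0// exprn_gt0// invr_gt0. Qed.

(** With [k = m + 2], [exp (1 / s)] is the [k]-th power of [exp (1 / (k s)) >= 1 / (k s)]; this
    gives [C = k ^ k]. The exponent 2 on the right is what makes the derivative at 0 vanish. *)
Lemma flat_le m : exists C : R, forall s, `|flat m s| <= C * s ^+ 2.
Proof.
exists ((m.+2)%:R ^+ m.+2) => s; have [s0|s0] := ltP 0 s; last first.
  by rewrite flat_le0// normr0 mulr_ge0 ?sqr_ge0// exprn_ge0.
rewrite ger0_norm ?(ltW (flat_gt0 m s0))// /flat s0.
have k0 : 0 < m.+2%:R :> R by [].
have ek : s^-1 ^+ m.+2 <= m.+2%:R ^+ m.+2 * expR (s^-1).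
  have -> : expR s^-1 = expR (s^-1 / m.+2%:R) ^+ m.+2.
    by rewrite -expRM_natl mulrC divfK// gt_eqF.
  rewrite -exprMn lerXn2r ?nnegrE ?mulr_ge0 ?invr_ge0 ?expR_ge0 ?(ltW s0)//.
  apply: (@le_trans _ _ (m.+2%:R * (s^-1 / m.+2%:R))).
    by rewrite mulrC divfK// gt_eqF.
  rewrite ler_pM2l//; apply: le_trans (expR_ge1Dx _).
  by rewrite lerDr.
rewrite expRN. rewrite ler_pdivrMr ?expR_gt0//.
rewrite -(@ler_pM2r _ (s^-1 ^+ 2)) ?exprn_gt0 ?invr_gt0// -exprD addn2.
apply: (le_trans ek); rewrite le_eqVlt; apply/orP; left; apply/eqP.
by field; rewrite gt_eqF.
Qed.

Let flat_deriv_gt0 m s : 0 < s ->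
  is_derive s 1 (fun y => y^-1 ^+ m * expR (- y^-1))
    (- m%:R * flat m.+1 s + flat m.+2 s).
Proof.
move=> s0; have sn0 : s != 0 by rewrite gt_eqF.
have dV : is_derive s 1 (fun y => y^-1) (- s ^- 2).
  apply: is_derive_eq; first exact: (@is_deriveV _ idfun).
  by rewrite /GRing.scale/= mulr1.
have dX := @is_deriveX _ _ _ m _ _ _ dV.
have dN := @is_deriveN _ _ _ _ _ _ _ dV.
have dE := @is_derive1_comp _ expR (- (fun y => y^-1)) s _ _ (is_derive_expR _) dN.
have dM := @is_deriveM _ _ _ _ _ _ _ _ dX dE.
rewrite (_ : (fun y => _) = ((fun y : R => y^-1) ^+ m * (expR \o - (fun y : R => y^-1)))).
  2: by apply/funext => y; rewrite !fctE.
apply: (is_derive_eq dM).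
rewrite /flat s0/= opprK /GRing.scale/= !fctE.
rewrite -!exprVn; case: m {dX dM} => [|m] /=; first by rewrite !expr0 !expr1 ; ring.
by rewrite !exprS; ring.
Qed.

Lemma is_derive_flat m s :
  is_derive s 1 (flat m) (- m%:R * flat m.+1 s + flat m.+2 s).
Proof.
have [s0|s0|->] := ltgtP s 0.
- rewrite !flat_le0 ?ltW// mulr0 addr0.
  apply: near_eq_is_derive (is_derive_cst 0 s 1).
  have : \forall z \near s, z < 0 by exact: lt_nbhsl.
  by apply: filterS => z z0; rewrite flat_le0// ltW.
- apply: near_eq_is_derive (flat_deriv_gt0 m s0).
  have : \forall z \near s, 0 < z by exact: lt_nbhsr.
  by apply: filterS => z z0; rewrite /flat z0.
- rewrite !flat_le0// mulr0 addr0.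
  (* At 0 the difference quotient is bounded by [C |h|], thanks to the quadratic bound. *)
  suff H : (fun h : R => h^-1 *: ((flat m \o shift 0) (h *: 1) - flat m 0)) @ 0^' --> 0.
    by apply: DeriveDef; [apply/cvg_ex; exists 0|apply/cvg_lim].
  have [C HC] := flat_le m.
  apply/cvgr0Pnorm_lt => e e0.
  have C0 : 0 < `|C| + 1 by rewrite ltr_wpDl.
  apply/nbhs_ballP; exists (e / (`|C| + 1)) => /=; first by rewrite divr_gt0.
  move=> h /=; rewrite -ball_normE /ball_/= sub0r normrN => he h0.
  rewrite /= addr0 (flat_le0 m (lexx 0)) subr0 /GRing.scale/= mulr1 normrM normfV.
  rewrite mulrC ltr_pdivrMr ?normr_gt0//.
  apply: (le_lt_trans (HC h)).
  apply: (@le_lt_trans _ _ ((`|C| + 1) * `|h| * `|h|)).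
    rewrite -mulrA -normrM -expr2 ger0_norm ?sqr_ge0// ler_wpM2r ?sqr_ge0//.
    by rewrite (le_trans (ler_norm C))// lerDl.
  by rewrite ltr_pM2r ?normr_gt0// mulrC -ltr_pdivlMr.
Qed.

End flat_function.

(** Turns directional derivatives into derivatives of one real variable, to which the mean value
    theorem and the fundamental theorem of calculus apply. *)
Lemma is_derive_line {R : realType} {d : nat} (f : 'rV[R]_d -> R) v x (t df : R) :
  is_derive (x + t *: v) v f df <-> is_derive t 1 (fun h => f (x + h *: v)) df.
Proof.
have E : (fun h : R => h^-1 *: ((f \o shift (x + t *: v)) (h *: v) - f (x + t *: v)))
    = (fun h : R => h^-1 *: (((fun h => f (x + h *: v)) \o shift t) (h *: 1)
       - f (x + t *: v))).
  apply/funext => h /=; rewrite /shift/= scalerDl.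
  by rewrite addrCA [h%:A]mulr1.
split => -[+ <-]; rewrite /derivable/= => dd.
- by apply: DeriveDef; rewrite /derivable /derive -E.
- by apply: DeriveDef; rewrite /derivable /derive E.
Qed.

Section smooth_bumps.
Context {R : realType} {d : nat}.
Local Notation V := 'rV[R]_d.

(** An algebra of differentiable functions that is stable under partial derivatives: all iterated
    derivatives of a member are again members, so smoothness follows by induction on the list of
    indices without computing any of them. *)
Inductive flat_algebra : (V -> R) -> Prop :=
| flat_algebra_coord m i (a b : R) :
    flat_algebra (fun x => flat m (a * x ord0 i + b))
| flat_algebra_cst (c : R) : flat_algebra (cst c)
| flat_algebra_add f g : flat_algebra f -> flat_algebra g -> flat_algebra (f + g)
| flat_algebra_mul f g : flat_algebra f -> flat_algebra g -> flat_algebra (f * g).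

Lemma flat_algebra_differentiable f x : flat_algebra f -> differentiable f x.
Proof.
elim=> [m i a b|c|g h _ ? _ ?|g h _ ? _ ?].
- rewrite (_ : (fun _ => _) = (flat m) \o (fun y : R => a * y + b) \o
    (fun v : V => v ord0 i))//.
  apply: differentiable_comp; first exact: differentiable_coord.
  apply: differentiable_comp; first exact: differentiableD.
  by apply/derivable1_diffP; apply: ex_derive; exact: is_derive_flat.
- exact: differentiable_cst.
- exact: differentiableD.
- exact: differentiableM.
Qed.

Lemma flat_algebra_partial f j : flat_algebra f -> flat_algebra (partial j f).
Proof.
elim=> [m i a b|c|g h Ag ? Ah ?|g h Ag ? Ah ?].
- have -> : partial j (fun x : V => flat m (a * x ord0 i + b)) =
    (cst (- m%:R * a * (i == j)%:R) * (fun x : V => flat m.+1 (a * x ord0 i + b)))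
    + (cst (a * (i == j)%:R) * (fun x : V => flat m.+2 (a * x ord0 i + b))).
    apply/funext => x; rewrite /partial.
    have [_ ->] : is_derive x (delta_mx ord0 j) (fun y : V => flat m (a * y ord0 i + b))
      ((- m%:R * flat m.+1 (a * x ord0 i + b) + flat m.+2 (a * x ord0 i + b))
       * (a * (i == j)%:R)).
      rewrite -[x in is_derive x _ _ _]addr0 -(scale0r (delta_mx ord0 j)).
      apply/is_derive_line.
      have -> : (fun h : R => flat m (a * (x + h *: delta_mx ord0 j : V) ord0 i + b))
          = flat m \o (fun h : R => (a * x ord0 i + b) + a * (i == j)%:R * h).
        by apply/funext => h /=; rewrite !mxE eqxx /= eq_sym; congr flat; ring.
      apply: is_derive1_comp.
        by rewrite mulr0 addr0; exact: is_derive_flat.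
      have D : is_derive (0 : R) 1 (cst (a * x ord0 i + b) + (a * (i == j)%:R) \*: id)
          (0 + (a * (i == j)%:R) *: 1).
        by apply: is_deriveD.
      by apply: (is_derive_eq D); rewrite add0r [LHS]mulr1.
    by rewrite !fctE; ring.
  apply: flat_algebra_add; apply: flat_algebra_mul;
    [exact: flat_algebra_cst|exact: flat_algebra_coord
    |exact: flat_algebra_cst|exact: flat_algebra_coord].
- rewrite (_ : partial j (cst c) = cst 0); first exact: flat_algebra_cst.
  by apply/funext => x; rewrite /partial derive_cst.
- rewrite (_ : partial j (g + h) = partial j g + partial j h).
    exact: flat_algebra_add.
  apply/funext => x; rewrite /partial deriveD//;
    exact/diff_derivable/flat_algebra_differentiable.
- rewrite (_ : partial j (g * h) = g * partial j h + h * partial j g).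
    by apply: flat_algebra_add; exact: flat_algebra_mul.
  apply/funext => x; rewrite /partial deriveM//;
    exact/diff_derivable/flat_algebra_differentiable.
Qed.

Lemma flat_algebra_smooth f : flat_algebra f -> smooth f.
Proof.
move=> Af s x; apply: flat_algebra_differentiable.
by elim: s => //= i s; exact: flat_algebra_partial.
Qed.

End smooth_bumps.

Section box_bumps.
Context {R : realType} {d : nat}.
Local Notation V := 'rV[R]_d.
Local Notation mu := (lebesgue_rV (R := R) d).
Implicit Types (a b : V).

Definition rV_obox a b : set V :=
  [set v | forall i, a ord0 i < v ord0 i < b ord0 i].

Definition rV_cbox a b : set V :=
  [set v | forall i, a ord0 i <= v ord0 i <= b ord0 i].

Lemma measurable_rV_obox a b : measurable (rV_obox a b).
Proof.
rewrite (_ : rV_obox a b =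
    [set v : V | forall i, `]a ord0 i, b ord0 i[%classic (v ord0 i)]).
  by apply: (@measurable_rV_box _ _ (fun i => `]a ord0 i, b ord0 i[%classic)).
by apply/seteqP; split => v H i; have := H i; rewrite /= in_itv.
Qed.

Lemma closed_rV_cbox a b : closed (rV_cbox a b).
Proof.
rewrite (_ : rV_cbox a b = \bigcap_(i in [set: 'I_d])
    (fun v : V => v ord0 i) @^-1` [set x | a ord0 i <= x <= b ord0 i]).
  apply: closed_bigI => i _; apply: preimage_closed.
    by move=> v _; exact: coord_continuous.
  rewrite (_ : [set x | _] =
        [set x | a ord0 i <= x] `&` [set x | x <= b ord0 i]).
    by apply: closedI; [exact: closed_ge|exact: closed_le].
  by apply/seteqP; split => x /=; [move/andP|move=> /andP].
by apply/seteqP; split => v H i; [move=> _|]; exact: H.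
Qed.

Lemma bounded_rV_cbox a b : bounded_set (rV_cbox a b).
Proof.
exists (`|a| + `|b|); split; first exact: num_real.
move=> M ltM v vab; have M0 : 0 < M.
  by apply: le_lt_trans ltM; rewrite addr_ge0.
apply/ltW/rV_normP => // i; apply: le_lt_trans ltM.
have ai := rV_norm_coord a i; have bi := rV_norm_coord b i.
have /andP[av vb] := vab i.
by move: ai bi; rewrite !ler_norml => /andP[? ?] /andP[? ?]; apply/andP; split; lra.
Qed.

(** The slope [n.+1] drives the arguments of [flat 0] to infinity inside the box, where [flat 0]
    tends to 1. The bumps thus converge boundedly to the indicator of the open box. *)
Definition box_bump a b n (x : V) : R :=
  \prod_(i < d) (flat 0 (n.+1%:R * x ord0 i - n.+1%:R * a ord0 i) *
                 flat 0 (- n.+1%:R * x ord0 i + n.+1%:R * b ord0 i)).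

Lemma smooth_box_bump a b n : smooth (box_bump a b n).
Proof.
apply: flat_algebra_smooth.
rewrite (_ : box_bump a b n = \prod_(i < d)
   ((fun x : V => flat 0 (n.+1%:R * x ord0 i + (- (n.+1%:R * a ord0 i)))) *
    (fun x : V => flat 0 (- n.+1%:R * x ord0 i + n.+1%:R * b ord0 i)))).
  apply: (big_ind (@flat_algebra R d)).
  - exact: (@flat_algebra_cst R d 1).
  - by move=> f g; exact: flat_algebra_mul.
  - by move=> i _; apply: flat_algebra_mul; exact: flat_algebra_coord.
apply/funext => x.
by apply: (big_ind2 (fun (r : R) (f : V -> R) => r = f x)) => // r f s g -> ->.
Qed.

Lemma flat0_le1 (s : R) : 0 <= flat 0 s <= 1.
Proof.
rewrite /flat; case: ifP => [s0|_]; last by rewrite lexx ler01.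
by rewrite expr0 mul1r expR_ge0/= expR_le1 oppr_le0 invr_ge0 ltW.
Qed.

Lemma box_bump_le1 a b n x : 0 <= box_bump a b n x <= 1.
Proof.
have H i : 0 <= flat 0 (n.+1%:R * x ord0 i - n.+1%:R * a ord0 i) *
                 flat 0 (- n.+1%:R * x ord0 i + n.+1%:R * b ord0 i) <= 1.
  set s := _ - _; set t := _ + _.
  have /andP[s0 s1] := flat0_le1 s; have /andP[t0 t1] := flat0_le1 t.
  by rewrite mulr_ge0//= mulr_ile1.
apply: (big_ind (fun r : R => 0 <= r <= 1)) => [|r s /andP[r0 r1] /andP[s0 s1]|i _].
- by rewrite ler01 lexx.
- by rewrite mulr_ge0//= mulr_ile1.
- exact: H.
Qed.

Lemma box_bump_out a b n x : ~ rV_obox a b x -> box_bump a b n x = 0.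
Proof.
move=> /existsNP[i /negP]; rewrite negb_and -!leNgt => iab.
have n0 : 0 < n.+1%:R :> R by [].
rewrite /box_bump (bigD1 i)//=.
have -> : flat 0 (n.+1%:R * x ord0 i - n.+1%:R * a ord0 i) *
    flat 0 (- n.+1%:R * x ord0 i + n.+1%:R * b ord0 i) = 0.
  case/orP : iab => iab.
  - by rewrite flat_le0 ?mul0r// subr_le0 ler_pM2l.
  - by rewrite [X in _ * X]flat_le0 ?mulr0// mulNr addrC subr_le0 ler_pM2l.
by rewrite mul0r.
Qed.

Lemma box_bump_cvg a b x : rV_obox a b x ->
  box_bump a b n x @[n --> \oo] --> (1 : R).
Proof.
have flat_cvg (y : R) : 0 < y -> flat 0 (n.+1%:R * y) @[n --> \oo] --> (1 : R).
  move=> y0; rewrite (_ : (fun n => _) =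
      (fun n => expR (- (n.+1%:R^-1 * y^-1)))); last first.
    by apply/funext => n; rewrite /flat mulr_gt0// expr0 mul1r invfM.
  rewrite -[X in _ --> X](@expR0 R).
  apply: continuous_cvg; first exact: continuous_expR.
  rewrite -oppr0; apply: cvgN; rewrite -[X in _ --> X](mul0r y^-1).
  by apply: cvgMl; exact: cvg_harmonic.
move=> xab; rewrite /box_bump.
rewrite [X in _ --> X](_ : 1 = \prod_(i < d) (1 * 1)); last first.
  by rewrite mulr1 big1.
apply: cvg_big => //= [|i _]; first exact: mul_continuous.
have /andP[ax xb] := xab i.
apply: cvgM.
- under eq_fun do rewrite -mulrBr; apply: flat_cvg; by rewrite subr_gt0.
- under eq_fun do rewrite mulNr addrC -mulrBr; apply: flat_cvg; by rewrite subr_gt0.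
Qed.

Lemma box_bump_test_function (U : set V) a b n : rV_cbox a b `<=` U ->
  test_function U (box_bump a b n).
Proof.
move=> abU.
have sub : closure [set x | box_bump a b n x != 0] `<=` rV_cbox a b.
  rewrite [X in _ `<=` X](closure_id _).1; last exact: closed_rV_cbox.
  apply: closure_subset => x /= xn0.
  have /contrapT xab : ~ ~ rV_obox a b x.
    by move=> /(@box_bump_out a b n)/eqP; apply/negP.
  by move=> i; have /andP[/ltW-> /ltW->] := xab i.
split; first exact: smooth_box_bump.
- apply: bounded_closed_compact; last exact: closed_closure.
  have [M [Mr HM]] := bounded_rV_cbox a b; exists M; split => // y My v /sub vab.
  exact: HM.
- exact: subset_trans abU.
Qed.

End box_bumps.

(** * The fundamental lemma of the calculus of variations *)

Section fundamental_lemma.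
Context {R : realType} {d : nat}.
Local Notation V := 'rV[R]_d.
Local Notation mu := (lebesgue_rV (R := R) d).

Lemma continuous_smooth (f : V -> R) : smooth f -> continuous f.
Proof. by move=> sf x; apply: differentiable_continuous; exact: (sf [::] x). Qed.

(** A pi-system chosen for its traces: an orthant meets an open box in an open box with the same
    upper corner, which is again within reach of the bumps. *)
Definition rV_orthants : set (set V) :=
  [set A : set V | exists a : V, A = [set v : V | forall i, a ord0 i < v ord0 i]].

Lemma rV_orthants_sigma : (measurable : set (set V)) = <<s rV_orthants >>.
Proof.
apply: rV_sigma_generated.
  move=> _ [a ->]; rewrite (_ : [set v | _] =
    [set v : V | forall i, `]a ord0 i, +oo[%classic (v ord0 i)]).
    by apply: (@measurable_rV_box _ _ (fun i => `]a ord0 i, +oo[%classic)).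
  by apply/seteqP; split => v H i; have := H i; rewrite /= in_itv/= andbT.
move=> i A; rewrite RGenOInfty.measurableE => mA.
suff : <<s @RGenOInfty.G R >> `<=` [set A | <<s rV_orthants >> [set v : V | A (v ord0 i)]].
  exact.
have [s0 sC sU] := @smallest_sigma_algebra _ setT rV_orthants.
apply: smallest_sub.
  split.
  - exact: s0.
  - by move=> B HB; have := sC _ HB; rewrite !setTD.
  - by move=> F HF; exact: (sU _ HF).
move=> _ [x ->] /=.
(* A half-space in coordinate [i] is the union of the orthants whose other lower bounds are
   [- n]. *)
rewrite (_ : [set v | _] = \bigcup_n [set v : V |
    forall j, (if j == i then x else - n%:R) < v ord0 j]).
  apply: sU => n; apply: sub_sigma_algebra.
  exists (\row_j (if j == i then x else - n%:R)).
  by apply/seteqP; split => v H j; have := H j; rewrite mxE.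
apply/seteqP; split => v /=; rewrite in_itv/= andbT.
  move=> xv; exists (Num.bound `|v|) => // j; case: eqP => [->//|_].
  rewrite ltrNl (le_lt_trans (ler_norm _))// normrN.
  by rewrite (le_lt_trans (rV_norm_coord v j))// archi_boundP.
by move=> [n _ /(_ i)]; rewrite eqxx.
Qed.

Variables (U : set V) (k : V -> R).
Hypotheses (oU : open U) (ik : mu.-integrable setT (EFin \o k)).
Hypothesis k0 : forall chi, test_function U chi ->
  \int[mu]_x (k x * chi x) = 0.

Let mk : measurable_fun setT k.
Proof. by apply/measurable_EFinP; exact: measurable_int ik. Qed.

(** The bumps are test functions converging to the indicator of the box, and [k] times a bump is
    dominated by [|k|]. *)
Let integral_obox0 (a b : V) : rV_cbox a b `<=` U ->
  (\int[mu]_(x in rV_obox a b) (k x)%:E)%E = 0%E.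
Proof.
move=> abU; rewrite integral_mkcond.
pose f_ n x := (k x * box_bump a b n x)%:E.
have mb n : measurable_fun setT (box_bump a b n).
  apply: continuous_measurable_rV; apply: continuous_smooth.
  exact: smooth_box_bump.
have mf n : measurable_fun setT (f_ n).
  by apply/measurable_EFinP; exact: measurable_funM.
have mg : measurable_fun setT ((EFin \o k) \_ (rV_obox a b)).
  apply/(measurable_restrictT _ (measurable_rV_obox a b)).
  exact: measurable_funTS (measurable_int mu ik).
have f_f : {ae mu, forall x, setT x -> f_ ^~ x @ \oo --> ((EFin \o k) \_ (rV_obox a b)) x}.
  apply: aeW => x _; rewrite patchE; case: ifPn => [/set_mem xab|/negP xab].
    apply: cvg_EFin; first exact: nearW.
    rewrite -[X in _ --> X]mulr1; apply: cvgMr; exact: box_bump_cvg.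
  rewrite (_ : f_ ^~ x = cst 0%E); first exact: cvg_cst.
  apply/funext => n; rewrite /f_ box_bump_out ?mulr0// => xab'; apply: xab.
  exact/mem_set.
have f_g : {ae mu, forall x n, setT x -> (`|f_ n x| <= (abse \o (EFin \o k)) x)%E}.
  apply: aeW => x n _; rewrite /f_ /= lee_fin normrM.
  have /andP[b0 b1] := box_bump_le1 a b n x.
  by rewrite ler_piMr// ger0_norm.
have [_ _] := dominated_convergence measurableT mf mg f_f (integrable_abse ik) f_g.
rewrite [X in X @ _ --> _](_ : _ = cst 0%E) => [/cvg_lim <-//|].
  by rewrite lim_cst.
apply/funext => n; have := k0 (box_bump_test_function n abU).
rewrite /Rintegral => H; rewrite -[LHS]fineK ?H//.
apply: integrable_fin_num => //.
apply: le_integrable ik => // x _ /=; rewrite lee_fin normrM.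
have /andP[b0 b1] := box_bump_le1 a b n x.
by rewrite ler_piMr// ger0_norm.
Qed.

(** The sets on whose trace in the box [k] integrates to 0 form a Dynkin system containing the
    orthants, hence all measurable sets. A function whose integral over every measurable subset
    vanishes is 0 almost everywhere. *)
Let ae0_box (a b : V) : rV_cbox a b `<=` U ->
  {ae mu, forall x, rV_obox a b x -> k x = 0}.
Proof.
move=> abU; have mB := measurable_rV_obox a b.
have iB := integrableS measurableT mB (@subsetT _ _) ik.
suff H : ae_eq mu (rV_obox a b) (EFin \o k) (cst 0%E).
  by apply: filterS H => x H /H [].
apply: integral_ae_eq => // E EB mE; rewrite integral0.
suff : <<s rV_orthants >> `<=`
    [set E | (\int[mu]_(x in E `&` rV_obox a b) (k x)%:E)%E = 0%E].
  by rewrite -rV_orthants_sigma => /(_ E mE) /=; rewrite setIidl.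
apply: dynkin_induction.
- exact: rV_orthants_sigma.
- move=> _ _ [x ->] [y ->]; exists (\row_i Num.max (x ord0 i) (y ord0 i)).
  apply/seteqP; split => v /=.
    by move=> [xv yv] i; rewrite mxE gt_max xv yv.
  by move=> H; split => i; have := H i; rewrite mxE gt_max => /andP[].
- by rewrite /= setTI integral_obox0.
- move=> _ [x ->] /=; rewrite (_ : _ `&` _ =
    rV_obox (\row_i Num.max (x ord0 i) (a ord0 i)) b).
    apply: integral_obox0; apply: subset_trans abU => v H i.
    by have := H i; rewrite mxE ge_max -andbA => /and3P[_ -> ->].
  apply/seteqP; split => v /=.
    by move=> [xv av] i; have /andP[ai ib] := av i; rewrite mxE gt_max xv ai ib.
  move=> H; split => i; have := H i; rewrite mxE gt_max -andbA => /and3P[]//.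
  by move=> _ -> ->.
- move=> S mS /= HS.
  have mSC := measurableC mS.
  have : (\int[mu]_(x in rV_obox a b) (k x)%:E)%E = 0%E by exact: integral_obox0.
  rewrite -[X in integral mu X](setTI (rV_obox a b)) -(setUv S) setIUl.
  rewrite integral_setU ?HS ?add0e//.
  + exact: measurableI.
  + exact: measurableI.
  + by apply/measurable_EFinP; exact: measurable_funTS.
  + by apply/disj_setPS => x [[Sx _] [/(_ Sx)]].
- move=> F mF tF HF /=; rewrite setI_bigcupl integral_bigcup.
  + by apply: eseries0 => n _ _; exact: HF.
  + exact: trivIset_setIr.
  + by move=> n; exact: measurableI.
  + apply: integrableS ik => //; apply: bigcup_measurable => n _.
    exact: measurableI.
Qed.

Lemma fundamental_lemma_variations : {ae mu, forall x, U x -> k x = 0}.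
Proof.
pose q (p : 'rV[rat]_d * nat) : V := map_mx ratr p.1.
pose r (p : 'rV[rat]_d * nat) : R := p.2.+1%:R^-1.
have H p : {ae mu, forall x, ball (q p) (2 * r p) `<=` U -> ball (q p) (r p) x -> k x = 0}.
  have r0 : 0 < r p by rewrite invr_gt0.
  have r20 : 0 < 2 * r p by rewrite mulr_gt0.
  have [pU|pU] := pselect (ball (q p) (2 * r p) `<=` U); last first.
    by apply: aeW => x /pU.
  apply: filterS (@ae0_box (q p - const_mx (r p)) (q p + const_mx (r p)) _).
    move=> x + _ xq; apply => i; move: xq.
    rewrite -ball_normE /ball_/= => /rV_normP-/(_ r0)/(_ i).
    by rewrite !mxE distrC ltr_distl.
  move=> x xq; apply: pU; rewrite -ball_normE /ball_/=.
  apply/rV_normP => // i; have := xq i; rewrite !mxE.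
  by rewrite -ler_distl distrC => /le_lt_trans; apply; rewrite ltr_pMl// ltr1n.
(* The rational balls are enumerated by natural numbers, so that countably many null sets are
   discarded at once. *)
have : {ae mu, forall x, forall n p, unpickle n = Some p ->
    ball (q p) (2 * r p) `<=` U -> ball (q p) (r p) x -> k x = 0}.
  apply: ae_foralln => n.
  case: (unpickle n) => [p|]; last exact: aeW.
  by apply: filterS (H p) => x Hx _ [<-].
apply: filterS => x Hx; rewrite [X in X x -> _](open_rV_bigcup_ball oU).
by move=> [p pU xp]; exact: (Hx (pickle p) p (pickleK p) pU xp).
Qed.

End fundamental_lemma.

(** * Increments along a coordinate axis *)

Section Rintegral_fubini.
Context d1 d2 (T1 : measurableType d1) (T2 : measurableType d2) (R : realType).
Variables (m1 : {sigma_finite_measure set T1 -> \bar R})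
  (m2 : {sigma_finite_measure set T2 -> \bar R}) (f : T1 * T2 -> R).
Hypothesis fi : (m1 \x m2)%E.-integrable setT (EFin \o f).

Lemma ae_integrable_Rfubini1 :
  {ae m1, forall x, m2.-integrable setT (EFin \o (fun y => f (x, y)))}.
Proof. exact: (ae_integrable1 fi). Qed.

Lemma ae_integrable_Rfubini2 :
  {ae m2, forall y, m1.-integrable setT (EFin \o (fun x => f (x, y)))}.
Proof. exact: (ae_integrable2 fi). Qed.

(** On the exceptional set [fine] may turn an infinite inner integral into 0; the result is still
    dominated by the extended-valued partial integral. *)
Lemma integrable_Rfubini1 :
  m1.-integrable setT (EFin \o (fun x => Rintegral m2 setT (fun y => f (x, y)))).
Proof.
have iF := integrable_fubini_F fi.
have mF := measurable_int _ iF.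
apply: (le_integrable measurableT _ _ iF).
  by apply/measurable_EFinP; exact: measurableT_comp.
move=> x _ /=; rewrite /Rintegral /fubini_F.
by case: (\int[m2]_y _)%E => //=; rewrite ?normr0 ?leey.
Qed.

Lemma measurable_Rfubini2 :
  measurable_fun setT (fun y => Rintegral m1 setT (fun x => f (x, y))).
Proof. by apply: measurableT_comp (measurable_fubini_G fi). Qed.

Lemma Rfubini :
  Rintegral m1 setT (fun x => Rintegral m2 setT (fun y => f (x, y))) =
  Rintegral m2 setT (fun y => Rintegral m1 setT (fun x => f (x, y))).
Proof.
have F := Fubini fi; rewrite /= in F.
rewrite [LHS]/Rintegral [RHS]/Rintegral; congr fine.
transitivity (\int[m1]_x \int[m2]_y (f (x, y))%:E)%E.
  apply: ae_eq_integral_nomeas; apply: filterS ae_integrable_Rfubini1 => x ix _.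
  by rewrite /Rintegral fineK//; exact: integrable_fin_num.
rewrite F; apply: ae_eq_integral_nomeas.
apply: filterS ae_integrable_Rfubini2 => x ix _.
by rewrite /Rintegral fineK//; exact: integrable_fin_num.
Qed.

End Rintegral_fubini.

Section shear.
Context {R : realType} {d : nat}.
Local Notation V := 'rV[R]_d.
Local Notation mu := (lebesgue_rV (R := R) d).
Local Notation lam := (@lebesgue_measure R).
Variables (e : V) (h : R).
Hypothesis h0 : 0 <= h.

Lemma measurable_shear :
  measurable_fun setT (fun p : V * measurableTypeR R => p.1 + p.2 *: e).
Proof.
apply: measurable_fun_rVP => i.
rewrite (_ : (fun _ => _) =
    (fun p : V * measurableTypeR R => p.1 ord0 i + p.2 * e ord0 i)).
  apply: measurable_funD.
    by apply: measurableT_comp (measurable_rV_coord i) _.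
  exact: measurable_funM.
by apply/funext => p; rewrite !mxE.
Qed.

(** Integrals over [[0, h]] are written as integrals over the whole line against this indicator, so
    that Fubini is always applied on the full product space. *)
Definition window (t : measurableTypeR R) : R := \1_(`[0, h]%classic) t.

Lemma window_out t : ~~ (0 <= t <= h) -> window t = 0.
Proof.
by move=> th; rewrite /window indicE memNset// /= in_itv/=; apply/negP.
Qed.

Lemma window_in t : 0 <= t <= h -> window t = 1.
Proof. by move=> th; rewrite /window indicE mem_set// /= in_itv/=. Qed.

Lemma window_ge0 t : 0 <= window t. Proof. by rewrite /window indicE. Qed.

Lemma measurable_window : measurable_fun setT window.
Proof. exact: measurable_indic. Qed.

Lemma integrable_window : lam.-integrable setT (EFin \o window).
Proof. exact: integrable_indic_itv. Qed.

Lemma Rintegral_window_mul (f : R -> R) :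
  Rintegral lam setT (fun t => f t * window t) = \int[lam]_(t in `[0, h]) f t.
Proof.
rewrite [RHS]Rintegral_mkcond; congr Rintegral; apply/funext => t.
by rewrite patchE /window indicE; case: ifP => _; rewrite ?mulr1 ?mulr0.
Qed.

Lemma Rintegral_window : Rintegral lam setT window = h.
Proof.
rewrite (_ : window = (fun t => 1 * window t)); last first.
  by apply/funext => t; rewrite mul1r.
rewrite Rintegral_window_mul Rintegral_cst// mul1r.
have E := @lebesgue_measure_itv R `[0, h]; rewrite /= lte_fin in E.
transitivity (fine (if 0 < h then (h%:E - 0)%E else 0%E)); first by congr fine.
by case: ltP => [_|h0'] /=; [rewrite subr0|apply/eqP; rewrite eq_le h0 h0'].
Qed.

Variables (g : V -> R) (M : V * measurableTypeR R -> R) (C : R).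
Hypotheses (ig : mu.-integrable setT (EFin \o g)) (mM : measurable_fun setT M)
  (MC : forall p, `|M p| <= C).

(** Tonelli, integrating over space first: by translation invariance the inner integral of
    [|g (x + t e)|] does not depend on [t], which leaves the bound [C N] times the window. The
    multiplier [M] lets one statement serve constants, functions of [x] alone and translated test
    functions. *)
Lemma integrable_shear : (mu \x lam)%E.-integrable setT
  (EFin \o (fun p : V * measurableTypeR R =>
     M p * g (p.1 + p.2 *: e) * window p.2)).
Proof.
have mg : measurable_fun setT g.
  by apply/measurable_EFinP; exact: measurable_int ig.
have mf : measurable_fun setT (fun p : V * measurableTypeR R =>
     M p * g (p.1 + p.2 *: e) * window p.2).
  apply: measurable_funM; last first.
    by apply: measurableT_comp => //; exact: measurable_window.
  apply: measurable_funM => //.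
  exact: (measurableT_comp mg measurable_shear).
apply/integrable21ltyP; first exact/measurable_EFinP.
have igN t : mu.-integrable setT (EFin \o (fun x : V => `|g (x + t *: e)|)).
  exact: (integrable_translate (t *: e) (integrable_norm ig)).
pose N := Rintegral mu setT (fun x => `|g x|).
apply: (@le_lt_trans _ _ (\int[lam]_t (C * N * window t)%:E)%E); last first.
  apply: integrable_lty => //; apply: eq_integrable (integrableZl _ (C * N) integrable_window) => //.
apply: ge0_le_integral => //.
- by move=> t _; exact: integral_ge0.
- apply: (@measurable_fun_fubini_tonelli_G _ _ _ _ R mu
    (fun p : V * measurableTypeR R => `|(M p * g (p.1 + p.2 *: e) * window p.2)%:E|%E)) => //.
  by apply: measurableT_comp => //; exact/measurable_EFinP.
- by apply/measurable_EFinP; apply: measurable_funM => //; exact: measurable_window.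
move=> t _.
have C0 : 0 <= C by apply: le_trans (MC (0, t)).
pose gt (x : V) : R := `|g (x + t *: e)|.
have -> : (C * N * window t)%:E =
    (\int[mu]_x ((C * window t)%:E * (EFin \o gt) x))%E.
  rewrite integralZl//; last exact: igN.
  rewrite -[X in (_ * X)%E]fineK; last exact/integrable_fin_num/igN.
  rewrite -EFinM; congr EFin.
  have -> : fine (\int[mu]_x (EFin \o gt) x)%E = N.
    exact: (Rintegral_translate (t *: e) (integrable_norm ig)).
  by rewrite mulrAC.
apply: ge0_le_integral => //.
- apply: measurableT_comp => //; apply/measurable_EFinP.
  exact: (measurableT_comp mf (measurable_pair2 t)).
- by apply: measurable_funeM; exact: measurable_int (igN t).
- move=> x _; rewrite /= lee_fin !normrM (ger0_norm (window_ge0 t)).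
  rewrite [leRHS]mulrAC.
  by rewrite ler_wpM2r ?window_ge0// ler_wpM2r.
Qed.

End shear.

(** * Calculus of test functions along a coordinate line *)

Section test_functions.
Context {R : realType} {d : nat}.
Local Notation V := 'rV[R]_d.
Local Notation lam := (@lebesgue_measure R).
Implicit Types (f chi : V -> R) (U Om : set V) (i : 'I_d) (v x : V).
Local Notation e_ i := (delta_mx ord0 i : V).

Lemma smooth_partial f i : smooth f -> smooth (partial i f).
Proof. by move=> sf s x; have := sf (rcons s i) x; rewrite foldr_rcons. Qed.

Lemma is_derive_smooth f i x (t : R) : smooth f ->
  is_derive t 1 (fun s : R => f (x + s *: e_ i)) (partial i f (x + t *: e_ i)).
Proof.
move=> sf; apply/is_derive_line/derivableP; apply: diff_derivable.
exact: (sf [::]).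
Qed.

Lemma partial_support f i :
  closure [set x | partial i f x != 0] `<=` closure [set x | f x != 0].
Proof.
rewrite [X in _ `<=` X](closure_id _).1; last exact: closed_closure.
apply: closure_subset => x /=; apply: contraNP => xf.
have : \forall y \near x, f y = 0.
  have : nbhs x (~` closure [set x | f x != 0]).
    by apply: open_nbhs_nbhs; split => //; apply: closed_openC; exact: closed_closure.
  apply: filterS => y yf; apply/eqP; apply: contrapT => /negP fy.
  by apply: yf; exact: subset_closure.
move=> xf0; rewrite /partial (@near_eq_derive _ _ _ f (cst 0))//.
by rewrite derive_cst.
Qed.

Lemma test_function_partial U chi i :
  test_function U chi -> test_function U (partial i chi).
Proof.
move=> [sc cc sub]; split; first exact: smooth_partial.
- apply: subclosed_compact cc _; first exact: closed_closure.
  exact: partial_support.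
- exact: subset_trans (@partial_support chi i) sub.
Qed.

Lemma test_function_bounded U chi : test_function U chi ->
  exists2 C : R, 0 <= C & forall x, `|chi x| <= C.
Proof.
move=> [sc cc _].
have cK : compact (chi @` closure [set x | chi x != 0]).
  apply: continuous_compact cc; apply: continuous_subspaceT.
  exact: continuous_smooth.
have [M [_ HM]] := compact_bounded cK.
exists (`|M| + 1); first by rewrite addr_ge0.
move=> x; have [->|cx] := eqVneq (chi x) 0; first by rewrite normr0 addr_ge0.
apply: HM; first by rewrite (le_lt_trans (ler_norm _))// ltrDl.
by exists x => //; exact: subset_closure.
Qed.

Lemma test_function_lipschitz U chi i : test_function U chi ->
  exists2 C : R, 0 <= C & forall x t, `|chi (x + t *: e_ i) - chi x| <= C * `|t|.
Proof.
move=> tc; have [sc _ _] := tc.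
have [C C0 HC] := test_function_bounded (test_function_partial i tc).
exists C => // x t.
have dl s := @is_derive_smooth chi i x s sc.
have cl (A : set R) : {within A, continuous (fun s : R => chi (x + s *: e_ i))}.
  apply: continuous_subspaceT => s; apply: differentiable_continuous.
  by apply/derivable1_diffP; case: (dl s).
have chi0 : chi x = chi (x + 0 *: e_ i) by rewrite scale0r addr0.
have [t0|t0] := leP 0 t.
  have [s _] := MVT_segment t0 (fun s _ => dl s) (cl _).
  by rewrite -chi0 subr0 => ->; rewrite normrM ler_wpM2r.
have [s _] := MVT_segment (ltW t0) (fun s _ => dl s) (cl _).
rewrite -chi0 sub0r => E.
by rewrite distrC E normrM normrN ler_wpM2r.
Qed.

(** [C] is a Lipschitz constant of the partial derivative: the mean value theorem produces that
    derivative at a point within distance [h] of [x]. *)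
Lemma test_function_taylor U chi i : test_function U chi ->
  exists2 C : R, 0 <= C & forall x (h : R), 0 <= h ->
    `|chi (x - h *: e_ i) - chi x + h * partial i chi x| <= C * h ^+ 2.
Proof.
move=> tc; have [sc _ _] := tc.
have [C C0 HC] := test_function_lipschitz i (test_function_partial i tc).
exists C => // x h h0.
have dl s := @is_derive_smooth chi i x s sc.
have cl (A : set R) : {within A, continuous (fun s : R => chi (x + s *: e_ i))}.
  apply: continuous_subspaceT => s; apply: differentiable_continuous.
  by apply/derivable1_diffP; case: (dl s).
have chi0 : chi x = chi (x + 0 *: e_ i) by rewrite scale0r addr0.
have h0' : - h <= 0 by rewrite oppr_le0.
have [s] := MVT_segment h0' (fun s _ => dl s) (cl _).
rewrite in_itv/= => /andP[sh s0].
rewrite -chi0 sub0r opprK -scaleNr => E.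
rewrite (_ : _ + _ = - (partial i chi (x + s *: e_ i) - partial i chi x) * h); last first.
  by rewrite mulNr mulrBl -E; ring.
rewrite normrM normrN (ger0_norm h0) expr2 mulrA ler_wpM2r//.
apply: (le_trans (HC x s)); rewrite ler_wpM2l//.
by rewrite ler0_norm// lerNl.
Qed.

Lemma partial_translate f v i :
  partial i (fun x => f (x - v)) = (fun x => partial i f (x - v)).
Proof.
apply/funext => x; rewrite /partial /derive.
set F := (fun h : R => _); set G := (fun h : R => _).
by suff -> : F = G by []; apply/funext => h; rewrite /F /G /= /shift/= addrA.
Qed.

Lemma smooth_translate f v : smooth f -> smooth (fun x => f (x - v)).
Proof.
move=> sf s x.
have -> : foldr (@partial R d) (fun x => f (x - v)) s =
    (fun x => foldr (@partial R d) f s (x - v)).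
  by elim: s => //= i s ->; rewrite partial_translate.
rewrite (_ : (fun _ => _) = (foldr (@partial R d) f s) \o (fun y => y - v))//.
apply: differentiable_comp; last exact: (sf s (x - v)).
exact: differentiableB.
Qed.

Lemma test_function_translate U Om chi v : test_function U chi ->
  (forall x, U x -> Om (x + v)) -> test_function Om (fun x => chi (x - v)).
Proof.
move=> [sc cc sub] UOm.
pose K := closure [set x | chi x != 0].
have KE : (fun x => x + v) @` K = (fun x => x - v) @^-1` K.
  apply/seteqP; split => [_ [y Ky <-]|y Ky] /=; first by rewrite addrK.
  by exists (y - v) => //; rewrite subrK.
have cK : closed ((fun x => x - v) @^-1` K).
  apply: preimage_closed; last exact: closed_closure.
  move=> y _; apply: differentiable_continuous; exact: differentiableB.
have sub' : closure [set x | chi (x - v) != 0] `<=` (fun x => x - v) @^-1` K.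
  rewrite [X in _ `<=` X](closure_id _).1//; apply: closure_subset => x /= xn.
  exact: subset_closure.
split; first exact: smooth_translate.
- apply: subclosed_compact sub'; first exact: closed_closure.
  rewrite -KE; apply: continuous_compact cc; apply: continuous_subspaceT.
  move=> y; apply: differentiable_continuous; exact: differentiableD.
- by move=> x /sub'; rewrite -KE => -[y Ky <-]; apply: UOm; exact: sub.
Qed.

Lemma Rintegral_partial_line f i x (h : R) : smooth f -> 0 < h ->
  Rintegral lam setT (fun t => partial i f (x - t *: e_ i) * window h t) =
  f x - f (x - h *: e_ i).
Proof.
move=> sf h0.
rewrite (Rintegral_window_mul h (fun t => partial i f (x - t *: e_ i))).
pose F (t : R) := - f (x - t *: e_ i).
have dF (t : R) : is_derive t 1 F (partial i f (x - t *: e_ i)).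
  have d1 := @is_derive_smooth f i x (- t) sf.
  have d2 : is_derive t (1 : R) (-%R : R -> R) (- 1) by exact: is_deriveNid.
  have d3 := @is_derive1_comp _ _ _ _ _ _ d1 d2.
  have d4 := @is_deriveN _ _ _ _ _ _ _ d3.
  rewrite (_ : F = - ((fun s : R => f (x + s *: e_ i)) \o -%R)); last first.
    by apply/funext => s; rewrite /F !fctE scaleNr.
  by apply: (is_derive_eq d4); rewrite mulrN1 opprK scaleNr.
have cdf : continuous (fun t : R => partial i f (x - t *: e_ i)).
  move=> t; apply: (@continuous_comp _ _ _ (fun t : R => x - t *: e_ i) (partial i f)).
    by apply: cvgB; [exact: cvg_cst|exact: scalel_continuous].
  by apply: continuous_smooth; exact: smooth_partial.
have cF : continuous F.
  move=> t; apply: differentiable_continuous.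
  by apply/derivable1_diffP; case: (dF t).
rewrite /Rintegral (@continuous_FTC2 _ _ F _ _ h0).
- by rewrite /F scale0r subr0 -EFinB/= opprK addrC.
- exact: continuous_subspaceT.
- split.
  + by move=> t _; case: (dF t).
  + by apply: cvg_at_right_filter; exact: cF.
  + by apply: cvg_at_left_filter; exact: cF.
- by move=> t _; rewrite derive1E; have [_ ->] := dF t.
Qed.

End test_functions.

Lemma integrable_bounded_mul d (T : measurableType d) (R : realType)
    (mu : {measure set T -> \bar R}) (D : set T) (m f : T -> R) (C : R) :
  measurable D -> measurable_fun D m -> (forall x, D x -> `|m x| <= C) ->
  mu.-integrable D (EFin \o f) -> mu.-integrable D (EFin \o (fun x => m x * f x)).
Proof.
move=> mD mm mC fi; have /measurable_EFinP mf := measurable_int _ fi.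
apply: (le_integrable mD _ _ (integrableZl mD C fi)).
  by apply/measurable_EFinP; exact: measurable_funM.
move=> x Dx /=; rewrite lee_fin !normrM ler_wpM2r//.
by rewrite (le_trans (mC x Dx))// ler_norm.
Qed.

Section increments.
Context {R : realType} {d : nat}.
Local Notation V := 'rV[R]_d.
Local Notation mu := (lebesgue_rV (R := R) d).
Local Notation lam := (@lebesgue_measure R).
Variables (Om : set V) (i : 'I_d) (u g : V -> R).
Local Notation e := (delta_mx ord0 i : V).
Hypotheses (iu : mu.-integrable setT (EFin \o u))
  (ig : mu.-integrable setT (EFin \o g))
  (ig2 : mu.-integrable setT (EFin \o (fun x => g x ^+ 2)))
  (wk : forall chi, test_function Om chi ->
    Rintegral mu setT (fun x => u x * partial i chi x) =
    - Rintegral mu setT (fun x => g x * chi x)).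

Let mu_ : measurable_fun setT u.
Proof. by apply/measurable_EFinP; exact: measurable_int iu. Qed.

Let mg : measurable_fun setT g.
Proof. by apply/measurable_EFinP; exact: measurable_int ig. Qed.

Definition line_int (h : R) (x : V) : R :=
  Rintegral lam setT (fun t => g (x + t *: e) * window h t).

(** The partner of [line_int] in Cauchy-Schwarz. Its space integral is [h] times the squared L^2
    norm of [g], the source of every O(h^2) below. *)
Definition line_int2 (h : R) (x : V) : R :=
  Rintegral lam setT (fun t => g (x + t *: e) ^+ 2 * window h t).

Let cst1 (p : V * measurableTypeR R) : `|cst (1 : R) p| <= 1.
Proof. by rewrite normr1. Qed.

Let shear1 h := integrable_shear e h ig (measurable_cst (1 : R)) cst1.
Let shear2 h := integrable_shear e h ig2 (measurable_cst (1 : R)) cst1.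

Lemma integrable_line_int h : mu.-integrable setT (EFin \o line_int h).
Proof.
rewrite (_ : line_int h = (fun x => Rintegral lam setT
    (fun t => cst 1 (x, t) * g (x + t *: e) * window h t))).
  exact: integrable_Rfubini1 (shear1 h).
by apply/funext => x; congr Rintegral; apply/funext => t; rewrite /= mul1r.
Qed.

Lemma integrable_line_int2 h : mu.-integrable setT (EFin \o line_int2 h).
Proof.
rewrite (_ : line_int2 h = (fun x => Rintegral lam setT
    (fun t => cst 1 (x, t) * g (x + t *: e) ^+ 2 * window h t))).
  exact: integrable_Rfubini1 (shear2 h).
by apply/funext => x; congr Rintegral; apply/funext => t; rewrite /= mul1r.
Qed.

Lemma Rintegral_line_int2 h : 0 <= h ->
  Rintegral mu setT (line_int2 h) = h * Rintegral mu setT (fun x => g x ^+ 2).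
Proof.
move=> h0; have F := Rfubini (shear2 h); rewrite /= in F.
transitivity (Rintegral lam setT (fun t => Rintegral mu setT (fun x => g x ^+ 2) * window h t)).
  rewrite (_ : line_int2 h = (fun x => Rintegral lam setT
      (fun t => 1 * g (x + t *: e) ^+ 2 * window h t))).
    rewrite F; congr Rintegral; apply/funext => t.
    rewrite -(Rintegral_translate (t *: e) ig2) -RintegralZr//; last first.
      exact: (integrable_translate (t *: e) ig2).
    by congr Rintegral; apply/funext => x; rewrite mul1r.
  by apply/funext => x; congr Rintegral; apply/funext => t; rewrite mul1r.
rewrite RintegralZl//; last exact: integrable_window.
by rewrite Rintegral_window// mulrC.
Qed.

Lemma ae_line_int_sqr h : 0 < h ->
  {ae mu, forall x, line_int h x ^+ 2 <= h * line_int2 h x}.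
Proof.
move=> h0; have h00 := ltW h0.
have H1 := ae_integrable_Rfubini1 (shear1 h).
have H2 := ae_integrable_Rfubini1 (shear2 h).
apply: filterS2 H1 H2 => x /= i1 i2.
have {}i1 : lam.-integrable setT (EFin \o (fun t => g (x + t *: e) * window h t)).
  by apply: eq_integrable i1 => // t _ /=; rewrite mul1r.
have {}i2 : lam.-integrable setT (EFin \o (fun t => g (x + t *: e) ^+ 2 * window h t)).
  by apply: eq_integrable i2 => // t _ /=; rewrite mul1r.
have iw := integrable_window h.
(* Cauchy-Schwarz as nonnegativity of a variance: [c] is the mean of [g] over the segment. It holds
   for almost every [x] only, since Fubini gives integrability on almost every line. *)
pose c := line_int h x / h.
have E : Rintegral lam setT (fun t => (g (x + t *: e) - c) ^+ 2 * window h t) =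
    line_int2 h x - 2 * c * line_int h x + c ^+ 2 * h.
  rewrite -[in X in _ + X](Rintegral_window h00) /line_int /line_int2.
  rewrite -RintegralZl// -RintegralZl//.
  have i1' : lam.-integrable setT (EFin \o (fun t => 2 * c * (g (x + t *: e) * window h t))).
    by apply: eq_integrable (integrableZl _ (2 * c) i1).
  have i3' : lam.-integrable setT (EFin \o (fun t => c ^+ 2 * window h t)).
    by apply: eq_integrable (integrableZl _ (c ^+ 2) iw).
  rewrite -RintegralB// -RintegralD//.
    by congr Rintegral; apply/funext => t; ring.
  by apply: eq_integrable (integrableB _ i2 i1').
have : 0 <= line_int2 h x - 2 * c * line_int h x + c ^+ 2 * h.
  rewrite -E; apply: Rintegral_ge0 => t _.
  by rewrite mulr_ge0 ?sqr_ge0 ?window_ge0.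
have -> : line_int2 h x - 2 * c * line_int h x + c ^+ 2 * h =
    (h * line_int2 h x - line_int h x ^+ 2) / h.
  by rewrite /c; field; rewrite gt_eqF.
by rewrite pmulr_lge0 ?invr_gt0// subr_ge0.
Qed.

Lemma Rintegral_mul_line_int h (m : V -> R) C : measurable_fun setT m ->
  (forall x, `|m x| <= C) ->
  Rintegral mu setT (fun x => m x * line_int h x) =
  Rintegral lam setT (fun t =>
    Rintegral mu setT (fun x : V => m x * g (x + t *: e)) * window h t).
Proof.
move=> mm mC.
have mm1 : measurable_fun setT (fun p : V * measurableTypeR R => m p.1).
  exact: measurableT_comp.
have sh := integrable_shear e h ig mm1 (fun p => mC p.1).
transitivity (Rintegral mu setT (fun x => Rintegral lam setT
    (fun t => m x * g (x + t *: e) * window h t))).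
  apply: ae_eq_Rintegral.
  have H1 := ae_integrable_Rfubini1 (shear1 h).
  apply: filterS H1 => x /= i1 _.
  have {}i1 : lam.-integrable setT (EFin \o (fun t => g (x + t *: e) * window h t)).
    by apply: eq_integrable i1 => // t _ /=; rewrite mul1r.
  rewrite -RintegralZl//.
  by congr Rintegral; apply/funext => t; rewrite mulrA.
have -> := Rfubini sh.
congr Rintegral; apply/funext => t /=; rewrite -RintegralZr//.
apply: (integrable_bounded_mul measurableT mm (fun x _ => mC x)).
exact: (integrable_translate (t *: e) ig).
Qed.

Variables (U : set V) (h : R).
Hypotheses (oU : open U) (h0 : 0 < h)
  (UOm : forall x t, U x -> 0 <= t <= h -> Om (x + t *: e)).

(** Translation moves the increment onto [chi], giving the integral of [u (chi (. - h e) - chi)].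
    For the line integral, each translate of [chi] by [t e] is a test function of [Om], so the weak
    derivative falls on [chi], and integrating over [t] recovers the same difference. *)
Let test_orthogonal chi : test_function U chi ->
  Rintegral mu setT (fun x : V => (u (x + h *: e) - u x - line_int h x) * chi x) = 0.
Proof.
move=> tc; have [sc _ _] := tc.
have [C C0 HC] := test_function_bounded tc.
have tp := test_function_partial i tc; have [sp _ _] := tp.
have [C' C'0 HC'] := test_function_bounded tp.
have mc : measurable_fun setT chi.
  by apply: continuous_measurable_rV; apply: continuous_smooth.
have mp : measurable_fun setT (partial i chi).
  by apply: continuous_measurable_rV; apply: continuous_smooth.
have i1 : mu.-integrable setT (EFin \o (fun x : V => chi x * u (x + h *: e))).
  apply: (integrable_bounded_mul measurableT mc (fun x _ => HC x)).
  exact: (integrable_translate _ iu).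
have i2 : mu.-integrable setT (EFin \o (fun x : V => chi x * u x)).
  exact: (integrable_bounded_mul measurableT mc (fun x _ => HC x)).
have i3 : mu.-integrable setT (EFin \o (fun x : V => chi x * line_int h x)).
  apply: (integrable_bounded_mul measurableT mc (fun x _ => HC x)).
  exact: integrable_line_int.
have ms (v : V) : measurable_fun setT (fun x : V => x - v).
  exact: measurable_fun_rV_translate.
have i4 : mu.-integrable setT (EFin \o (fun x : V => chi (x - h *: e) * u x)).
  apply: (@integrable_bounded_mul _ _ _ mu setT _ u C) => //.
  exact: (measurableT_comp mc).
transitivity (Rintegral mu setT (fun x : V => chi x * u (x + h *: e)) -
    Rintegral mu setT (fun x : V => chi x * u x) -
    Rintegral mu setT (fun x : V => chi x * line_int h x)).
  rewrite -RintegralB// -RintegralB//; last first.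
    by apply: eq_integrable (integrableB _ i1 i2).
  by congr Rintegral; apply/funext => x; ring.
have -> : Rintegral mu setT (fun x : V => chi x * u (x + h *: e)) =
    Rintegral mu setT (fun x : V => chi (x - h *: e) * u x).
  rewrite -[RHS](Rintegral_translate (h *: e) i4).
  by congr Rintegral; apply/funext => x; rewrite addrK.
rewrite (Rintegral_mul_line_int h mc HC).
pose M (p : V * measurableTypeR R) : R := - partial i chi (p.1 + p.2 *: - e).
have mM : measurable_fun setT M.
  apply: measurableT_comp => //.
  exact: (measurableT_comp mp (measurable_shear (- e))).
have MC p : `|M p| <= C' by rewrite normrN.
(* The shear direction is 0: after the integration by parts [u] is no longer translated and the
   dependence on [t] sits in the bounded factor [M]. *)
have sh := integrable_shear 0 h iu mM MC.
have -> : Rintegral lam setT (fun t =>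
    Rintegral mu setT (fun x : V => chi x * g (x + t *: e)) * window h t) =
  Rintegral lam setT (fun t =>
    Rintegral mu setT (fun x : V => M (x, t) * u (x + t *: 0) * window h t)).
  congr Rintegral; apply/funext => t.
  (* Outside the window the translate of [chi] may leave [Om], but there both sides are 0. *)
  have [th|th] := boolP (0 <= t <= h); last first.
    rewrite window_out// mulr0 [RHS](_ : _ = Rintegral mu setT (cst 0)).
      by rewrite /Rintegral integral0.
    by congr Rintegral; apply/funext => x; rewrite mulr0.
  have tt : test_function Om (fun x => chi (x - t *: e)).
    by apply: (test_function_translate tc) => x Ux; exact: UOm.
  rewrite window_in// mulr1.
  have -> : Rintegral mu setT (fun x : V => chi x * g (x + t *: e)) =
      Rintegral mu setT (fun x : V => g x * chi (x - t *: e)).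
    rewrite -[RHS](Rintegral_translate (t *: e)).
      by congr Rintegral; apply/funext => x; rewrite addrK mulrC.
    rewrite (_ : (fun x => g x * _) = (fun x : V => chi (x - t *: e) * g x)).
      apply: (@integrable_bounded_mul _ _ _ mu setT _ g C) => //.
      exact: (measurableT_comp mc).
    by apply/funext => x; rewrite mulrC.
  rewrite -[LHS]opprK -(wk tt) partial_translate.
  rewrite -mulN1r -RintegralZl//; last first.
    rewrite (_ : (fun x => u x * _) = (fun x : V => partial i chi (x - t *: e) * u x)).
      apply: (@integrable_bounded_mul _ _ _ mu setT _ u C') => //.
      exact: (measurableT_comp mp).
    by apply/funext => x; rewrite mulrC.
  congr Rintegral; apply/funext => x.
  by rewrite /M /= scaler0 addr0 mulr1 scalerN mulN1r mulrC mulNr.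
rewrite -(Rfubini sh) /=.
have -> : Rintegral mu setT (fun x => Rintegral lam setT
      (fun t => M (x, t) * u (x + t *: 0) * window h t)) =
    Rintegral mu setT (fun x : V => chi (x - h *: e) * u x) -
    Rintegral mu setT (fun x : V => chi x * u x).
  rewrite -RintegralB//; congr Rintegral; apply/funext => x.
  rewrite -mulrBl -(opprB (chi x)) -(Rintegral_partial_line i x sc h0).
  have ifp : lam.-integrable setT (EFin \o (fun t =>
      partial i chi (x - t *: e) * window h t)).
    apply: (@integrable_bounded_mul _ _ _ lam setT _ _ C') => //.
      have mx : measurable_fun setT (fun t : measurableTypeR R => (x, t)).
        exact: measurable_pair1.
      rewrite (_ : (fun _ => _) = (fun t => - M (x, t))).
        by apply: measurableT_comp => //; exact: (measurableT_comp mM mx).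
      by apply/funext => t; rewrite /M opprK/= scalerN.
    exact: integrable_window.
  rewrite mulNr mulrC -mulNr -RintegralZl//.
  congr Rintegral; apply/funext => t.
  by rewrite /M/= scaler0 addr0 scalerN; ring.
by ring.
Qed.

Lemma ae_increment :
  {ae mu, forall x : V, U x -> u (x + h *: e) - u x = line_int h x}.
Proof.
have ik : mu.-integrable setT (EFin \o (fun x : V => u (x + h *: e) - u x - line_int h x)).
  have iT := integrable_translate (h *: e) iu.
  by apply: eq_integrable (integrableB _ (integrableB _ iT iu) (integrable_line_int h)).
have := fundamental_lemma_variations oU ik test_orthogonal.
by apply: filterS => x H /H /eqP; rewrite subr_eq0 => /eqP.
Qed.

End increments.

(** * The chain rule for weak derivatives *)

Section compact_margin.
Context {R : realType} {d : nat}.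
Local Notation V := 'rV[R]_d.

Lemma compact_open_margin (K Om : set V) : compact K -> open Om -> K `<=` Om ->
  exists2 r : R, 0 < r & forall y, K y -> ball y r `<=` Om.
Proof.
move=> /compact_near_coveringP cK oOm KOm.
have H : \forall r \near (0 : R)^'+, K `<=` (fun y => ball y r `<=` Om).
  apply: cK => y Ky.
  have /nbhs_ballP[r /= r0 rOm] := open_nbhs_nbhs (conj oOm (KOm _ Ky)).
  have r20 : 0 < r / 2 by rewrite divr_gt0.
  exists (ball y (r / 2), [set s | s < r / 2]) => /=.
    split; first exact: nbhsx_ballx.
    by exists (r / 2) => //= s /=; rewrite sub0r normrN => + s0; rewrite gtr0_norm.
  move=> [z s] /= [zy sr] w zw; apply: rOm.
  rewrite [r]splitr; apply: ball_triangle zy _.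
  by apply: le_ball zw; exact: ltW.
have H2 : \forall r \near (0 : R)^'+, 0 < r /\ K `<=` (fun y => ball y r `<=` Om).
  by apply: filterS2 (nbhs_right_gt (0 : R)) H.
by have [r [r0 rK]] := filter_ex H2; exists r.
Qed.

End compact_margin.

Section chain_rule.
Context {R : realType} {d : nat}.
Local Notation V := 'rV[R]_d.
Local Notation mu := (lebesgue_rV (R := R) d).
Local Notation lam := (@lebesgue_measure R).
Variables (Om : set V) (oOm : open Om) (bOm : bounded_set Om).

(** [|f| <= 1 + f ^ 2] and [Om] has finite measure, so square integrable functions are integrable.
    The extension by zero puts them on the whole space, where translations act. *)
Lemma in_L2_restrict (f : V -> R) : in_L2 Om f ->
  mu.-integrable Om (EFin \o f) /\
  mu.-integrable setT (EFin \o (f \_ Om)) /\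
  mu.-integrable setT (EFin \o (fun x => (f \_ Om) x ^+ 2)).
Proof.
have mOm := open_measurable_rV oOm.
move=> [mf f2].
have i1 : mu.-integrable Om (EFin \o (fun x => 1 + f x ^+ 2)).
  have i1 : mu.-integrable Om (EFin \o cst 1).
    apply: measurable_bounded_integrable => //.
      exact: lebesgue_rV_bounded.
    exists 1; split; first exact: num_real.
    by move=> M M1 x _; rewrite /= normr1 ltW.
  exact: eq_integrable (integrableD mOm i1 f2).
have fi : mu.-integrable Om (EFin \o f).
  apply: (ae_le_integrable mOm mf i1); apply: aeW => x _.
  by rewrite ler_norml; apply/andP; split; nra.
split=> //; split.
  by rewrite -restrict_EFin; apply/(integrable_mkcond _ mOm).
rewrite (_ : (fun x => _) = (fun x => f x ^+ 2) \_ Om).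
  by rewrite -restrict_EFin; apply/(integrable_mkcond _ mOm).
by apply/funext => x; rewrite !patchE; case: ifP => // _; rewrite expr0n.
Qed.

Lemma inner_L2_restrict (f k : V -> R) :
  inner_L2 Om f k = Rintegral mu setT (fun x => (f \_ Om) x * k x).
Proof.
rewrite /inner_L2 Rintegral_mkcond; congr Rintegral; apply/funext => x.
by rewrite !patchE; case: ifP => // _; rewrite mul0r.
Qed.

Variables (i : 'I_d) (u g : V -> R).
Hypotheses (u2 : in_L2 Om u) (g2 : in_L2 Om g) (ug : is_weak_partial Om i u g).
Local Notation e := (delta_mx ord0 i : V).
Variables (phi dphi : R -> R) (L C : R).
Hypotheses (mdphi : measurable_fun setT dphi) (L0 : 0 <= L) (C0 : 0 <= C)
  (phi_taylor : forall a b, `|phi b - phi a - dphi a * (b - a)| <= L * (b - a) ^+ 2)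
  (dphi_lip : forall a b, `|dphi b - dphi a| <= L * `|b - a|)
  (dphi_bnd : forall a, `|dphi a| <= C)
  (phiu2 : in_L2 Om (phi \o u)).

Local Notation ut := (u \_ Om).
Local Notation gt := (g \_ Om).
Local Notation pt := ((phi \o u) \_ Om).

Let iu : mu.-integrable setT (EFin \o ut). Proof. exact: (in_L2_restrict u2).2.1. Qed.
Let ig : mu.-integrable setT (EFin \o gt). Proof. exact: (in_L2_restrict g2).2.1. Qed.
Let ig2 : mu.-integrable setT (EFin \o (fun x => gt x ^+ 2)).
Proof. exact: (in_L2_restrict g2).2.2. Qed.
Let ip : mu.-integrable setT (EFin \o pt). Proof. exact: (in_L2_restrict phiu2).2.1. Qed.

Let wk chi : test_function Om chi ->
  Rintegral mu setT (fun x => ut x * partial i chi x) =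
  - Rintegral mu setT (fun x => gt x * chi x).
Proof. by move=> /ug; rewrite !inner_L2_restrict. Qed.

Section fixed_test_function.
Variable psi : V -> R.
Hypothesis tpsi : test_function Om psi.
Let K := closure [set x | psi x != 0].
Variables (r : R).
Hypotheses (r0 : 0 < r) (rOm : forall y, K y -> ball y (2 * r) `<=` Om).
Variables (B B' C2 : R).
Hypotheses (B0 : 0 <= B) (B'0 : 0 <= B') (C20 : 0 <= C2)
  (psiB : forall x, `|psi x| <= B)
  (psiB' : forall x t, `|psi (x + t *: e) - psi x| <= B' * `|t|)
  (psiC2 : forall x h, 0 <= h ->
    `|psi (x - h *: e) - psi x + h * partial i psi x| <= C2 * h ^+ 2).

(** The [r]-neighbourhood of the support of [psi]. The margin is [2 r], so a shift by at most [r]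
    from [U] stays in [Om]. *)
Let U : set V := \bigcup_(y in K) ball y r.

Let oU : open U.
Proof. by apply: bigcup_open => y _; exact: ball_open. Qed.

Let UOm x t : U x -> 0 <= t <= r -> Om (x + t *: e).
Proof.
move=> [y Ky xy] /andP[t0 tr]; apply: (rOm Ky).
move: xy; rewrite -!ball_normE /ball_/= => /rV_normP-/(_ r0) xy.
apply/rV_normP => [|j]; first by rewrite mulr_gt0.
have := xy j; rewrite !mxE !ltr_norml eqxx => /andP[x1 x2].
by case: (j == i); rewrite ?mulr1 ?mulr0; apply/andP; split; lra.
Qed.

Let UOm0 x : U x -> Om x.
Proof. by move=> Ux; have := @UOm x 0 Ux; rewrite scale0r addr0; apply; rewrite lexx ltW. Qed.

Let psi_U x : psi x != 0 -> U x.
Proof.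
by move=> px; exists x; [exact: subset_closure|exact: ballxx].
Qed.

Let psi_shift_U x t : 0 <= t < r -> psi (x + t *: e) != 0 -> U x.
Proof.
move=> /andP[t0 tr] px; exists (x + t *: e); first exact: subset_closure.
rewrite -ball_normE /ball_/=; apply/rV_normP => // j; rewrite !mxE addrAC subrr add0r eqxx.
by case: (j == i); rewrite ?mulr1 ?mulr0 ?normr0// ger0_norm.
Qed.

Let m x := dphi (ut x) * psi x.

Let mut : measurable_fun setT ut.
Proof. by apply/measurable_EFinP; exact: measurable_int iu. Qed.

Let mpsi : measurable_fun setT psi.
Proof.
by have [sp _ _] := tpsi; apply: continuous_measurable_rV; apply: continuous_smooth.
Qed.

Let mm : measurable_fun setT m.
Proof. by apply: measurable_funM => //; exact: measurableT_comp. Qed.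

Let m_bnd x : `|m x| <= C * B.
Proof. by rewrite normrM ler_pM. Qed.

Let N := Rintegral mu setT (fun x => gt x ^+ 2).
Let N1 := Rintegral mu setT (fun x => `|gt x|).
Let P1 := Rintegral mu setT (fun x => `|pt x|).
Let J t := Rintegral mu setT (fun x : V => m x * gt (x + t *: e)).
Let J0 := Rintegral mu setT (fun x => m x * gt x).
(** The Lipschitz constant of [J] at 0: the first term comes from the variation of [dphi (u)], an
    increment of [u] multiplied by [g], the second from the variation of [psi]. *)
Let K3 := L * B * N + C * B' * N1.

Let N1_ge0 : 0 <= N1. Proof. by apply: Rintegral_ge0. Qed.
Let N_ge0 : 0 <= N. Proof. by apply: Rintegral_ge0 => x _; exact: sqr_ge0. Qed.

Let ae_inc t : 0 < t -> t <= r ->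
  {ae mu, forall x : V, U x -> ut (x + t *: e) - ut x = line_int i gt t x}.
Proof.
move=> t0 tr; apply: (@ae_increment _ _ Om) => // x s Ux /andP[s0 st].
by apply: UOm => //; rewrite s0 (le_trans st).
Qed.

Let line_int2_ge0 t x : 0 <= line_int2 i gt t x.
Proof. by apply: Rintegral_ge0 => s _; rewrite mulr_ge0 ?sqr_ge0 ?window_ge0. Qed.

(** Translating the integral [J0] by [t e] rewrites the difference as the integral of
    [(m x - m (x + t e)) g (x + t e)]: only [m] is varied, and its variation is controlled by the
    increments of [u] and [psi]. *)
Let J_dist t : 0 <= t < r -> `|J t - J0| <= K3 * t.
Proof.
move=> /andP[]; rewrite le_eqVlt => /predU1P[<- _|t0 tr].
  rewrite (_ : J 0 = J0) ?subrr ?normr0 ?mulr0//.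
  by congr Rintegral; apply/funext => x; rewrite scale0r addr0.
have igt := integrable_translate (t *: e) ig.
have ig2t := integrable_translate (t *: e) ig2.
have mt := @measurable_fun_rV_translate R d (t *: e).
have im1 : mu.-integrable setT (EFin \o (fun x : V => m x * gt (x + t *: e))).
  exact: (integrable_bounded_mul measurableT mm (fun x _ => m_bnd x)).
have im0 : mu.-integrable setT (EFin \o (fun x : V => m x * gt x)).
  exact: (integrable_bounded_mul measurableT mm (fun x _ => m_bnd x)).
have im2 := integrable_translate (t *: e) im0.
rewrite /J /J0 -(Rintegral_translate (t *: e) im0) -RintegralB//.
have iW := integrable_line_int2 i ig2 t.
pose bd (x : V) := (L * B / 2) * line_int2 i gt t x +
   (L * B / 2 * t) * gt (x + t *: e) ^+ 2 + (C * B' * t) * `|gt (x + t *: e)|.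
have ib1 := integrableZl measurableT (L * B / 2) iW.
have ib2 := integrableZl measurableT (L * B / 2 * t) ig2t.
have ib3 := integrableZl measurableT (C * B' * t) (integrable_norm igt).
have ib12 : mu.-integrable setT (EFin \o (fun x : V => (L * B / 2) * line_int2 i gt t x +
   (L * B / 2 * t) * gt (x + t *: e) ^+ 2)).
  exact: eq_integrable (integrableD measurableT ib1 ib2).
have ib : mu.-integrable setT (EFin \o bd).
  exact: eq_integrable (integrableD measurableT ib12 ib3).
have E : Rintegral mu setT bd = K3 * t.
  rewrite /bd RintegralD// RintegralD// !RintegralZl//; last exact: integrable_norm.
  rewrite (Rintegral_line_int2 i ig2 (ltW t0)) (Rintegral_translate (t *: e) ig2).
  rewrite (Rintegral_translate (t *: e) (integrable_norm ig)) -/N -/N1 /K3.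
  by field.
rewrite -E; apply: ae_normr_Rintegral => //.
  exact: eq_integrable (integrableB measurableT im1 im2).
have V2 := ae_line_int_sqr i ig ig2 t0.
apply: filterS2 (ae_inc t0 (ltW tr)) V2 => x incx V2x _.
rewrite /bd -mulrBl normrM.
set G := `|gt (x + t *: e)|.
have G2 : gt (x + t *: e) ^+ 2 = G ^+ 2 by rewrite /G real_normK// num_real.
rewrite G2.
have G0 : 0 <= G by exact: normr_ge0.
have W0 := line_int2_ge0 t x.
have bd0 : 0 <= L * B / 2 * line_int2 i gt t x + L * B / 2 * t * G ^+ 2 + C * B' * t * G.
  by rewrite !addr_ge0// !mulr_ge0 ?(ltW t0).
(* If [psi] is nonzero at [x] or at [x + t e] then [x] lies in [U], where the increment formula
   holds; otherwise both values of [m] vanish. *)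
suff main : U x -> `|m x - m (x + t *: e)| * G <= L * B / 2 * line_int2 i gt t x +
    L * B / 2 * t * G ^+ 2 + C * B' * t * G.
  have [px|px] := eqVneq (psi x) 0; last by apply: main; exact: psi_U.
  have [pxt|pxt] := eqVneq (psi (x + t *: e)) 0.
    by rewrite /m px pxt !mulr0 subr0 normr0 mul0r.
  by apply: main; apply: (psi_shift_U _ pxt); rewrite ltW.
move=> Ux; have Vx := incx Ux.
set v := line_int i gt t x in V2x Vx.
have mle : `|m x - m (x + t *: e)| <= L * B * `|v| + C * B' * t.
  rewrite (_ : _ - _ = - ((dphi (ut (x + t *: e)) - dphi (ut x)) * psi x) -
      dphi (ut (x + t *: e)) * (psi (x + t *: e) - psi x)); last by rewrite /m; ring.
  rewrite (le_trans (ler_normB _ _))// normrN !normrM lerD//.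
    by rewrite mulrAC ler_pM// -Vx dphi_lip.
  rewrite -mulrA ler_pM//; apply: (le_trans (psiB' x t)).
  by rewrite ger0_norm// ltW.
apply: (@le_trans _ _ ((L * B * `|v| + C * B' * t) * G)); first by rewrite ler_wpM2r.
rewrite mulrDl lerD2r.
(* Young's inequality weighted by [t]: [2 t |v| G <= v ^ 2 + (t G) ^ 2], followed by [v ^ 2 <= t]
   times [line_int2] and division by [2 t]. *)
have vG : `|v| * G <= (line_int2 i gt t x + t * G ^+ 2) / 2.
  rewrite ler_pdivlMr// -(ler_pM2l t0).
  have v2 : `|v| ^+ 2 = v ^+ 2 by rewrite real_normK// num_real.
  apply: (@le_trans _ _ (`|v| ^+ 2 + (t * G) ^+ 2)).
    rewrite -subr_ge0 (_ : _ - _ = (`|v| - t * G) ^+ 2) ?sqr_ge0//; ring.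
  by rewrite v2 mulrDr lerD// le_eqVlt; apply/orP; left; apply/eqP; ring.
rewrite -mulrA (le_trans (ler_wpM2l _ vG)) ?mulr_ge0// le_eqVlt.
by apply/orP; left; apply/eqP; field.
Qed.

(** Three errors of order [h ^ 2] add up: [E1] replaces the difference of [psi] by its derivative;
    [E2], after discrete integration by parts, linearizes [phi (u)] along the increment; [E3]
    replaces the integral of [J] over [[0, h]] by [h * J0]. *)
Let dist_h h : 0 < h < r ->
  `|h * (Rintegral mu setT (fun x => pt x * partial i psi x) + J0)| <=
  (C2 * P1 + L * B * N + K3) * h ^+ 2.
Proof.
move=> /andP[h0 hr]; have h00 := ltW h0.
have tp := test_function_partial i tpsi; have [sp _ _] := tp.
have [D D0 HD] := test_function_bounded tp.
have mp : measurable_fun setT (partial i psi).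
  by apply: continuous_measurable_rV; apply: continuous_smooth.
have mt := @measurable_fun_rV_translate R d (- (h *: e)).
have ipp : mu.-integrable setT (EFin \o (fun x => pt x * partial i psi x)).
  apply: eq_integrable (integrable_bounded_mul measurableT mp (fun x _ => HD x) ip) => //.
  by move=> x _ /=; rewrite mulrC.
have ip0 : mu.-integrable setT (EFin \o (fun x => pt x * psi x)).
  apply: eq_integrable (integrable_bounded_mul measurableT mpsi (fun x _ => psiB x) ip) => //.
  by move=> x _ /=; rewrite mulrC.
have iph : mu.-integrable setT (EFin \o (fun x : V => pt x * psi (x - h *: e))).
  apply: eq_integrable (@integrable_bounded_mul _ _ _ mu setT
    (fun x : V => psi (x - h *: e)) pt B measurableT _ _ ip) => //.
  - by move=> x _ /=; rewrite mulrC.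
  - exact: (measurableT_comp mpsi mt).
pose Dh := Rintegral mu setT (fun x : V => pt x * psi (x - h *: e)) -
  Rintegral mu setT (fun x => pt x * psi x).
pose mV := Rintegral mu setT (fun x => m x * line_int i gt h x).
have E1 : `|Dh + h * Rintegral mu setT (fun x => pt x * partial i psi x)| <= C2 * P1 * h ^+ 2.
  have ih := integrableZl measurableT h ipp.
  have iD : mu.-integrable setT
      (EFin \o (fun x : V => pt x * psi (x - h *: e) - pt x * psi x)).
    exact: eq_integrable (integrableB measurableT iph ip0).
  rewrite /Dh -RintegralB// -RintegralZl// -RintegralD//.
  have iP := integrableZl measurableT (C2 * h ^+ 2) (integrable_norm ip).
  rewrite mulrAC /P1 -RintegralZl//; last exact: integrable_norm.
  apply: ae_normr_Rintegral => //.
    exact: eq_integrable (integrableD measurableT iD ih).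
  apply: aeW => x _.
  rewrite (_ : _ + _ = (psi (x - h *: e) - psi x + h * partial i psi x) * pt x); last by ring.
  by rewrite normrM ler_wpM2r// psiC2.
have iV := integrable_line_int i ig h.
have iW := integrable_line_int2 i ig2 h.
have imV : mu.-integrable setT (EFin \o (fun x : V => m x * line_int i gt h x)).
  exact: (integrable_bounded_mul measurableT mm (fun x _ => m_bnd x)).
have E2 : `|Dh - mV| <= L * B * N * h ^+ 2.
  have ips : mu.-integrable setT (EFin \o (fun x : V => pt (x + h *: e) * psi x)).
    apply: eq_integrable (integrable_translate (h *: e) iph) => // x _ /=.
    by rewrite addrK.
  have -> : Dh = Rintegral mu setT (fun x : V => (pt (x + h *: e) - pt x) * psi x).
    rewrite /Dh -(Rintegral_translate (h *: e) iph) -RintegralB//.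
      by congr Rintegral; apply/funext => x; rewrite addrK mulrBl.
    by apply: eq_integrable (integrable_translate (h *: e) iph).
  have iD : mu.-integrable setT
      (EFin \o (fun x : V => (pt (x + h *: e) - pt x) * psi x)).
    apply: eq_integrable (integrableB measurableT ips ip0) => // x _ /=.
    by rewrite -EFinB mulrBl.
  rewrite /mV -RintegralB//.
  (* One factor [h] comes from Cauchy-Schwarz applied to the squared increment, the other from the
     space integral of [line_int2]. *)
  have -> : L * B * N * h ^+ 2 = Rintegral mu setT (fun x => L * B * h * line_int2 i gt h x).
    by rewrite RintegralZl// (Rintegral_line_int2 i ig2 h00) -/N; ring.
  apply: ae_normr_Rintegral => //.
  - exact: eq_integrable (integrableB measurableT iD imV).
  - exact: eq_integrable (integrableZl measurableT (L * B * h) iW).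
  have V2 := ae_line_int_sqr i ig ig2 h0.
  apply: filterS2 (ae_inc h0 (ltW hr)) V2 => x incx V2x _.
  have W0 := line_int2_ge0 h x.
  have [px|px] := eqVneq (psi x) 0.
    by rewrite /m px !mulr0 mul0r subr0 normr0 !mulr_ge0.
  have Ux := psi_U px; have Vx := incx Ux.
  have Ox := UOm0 Ux; have Oxh : Om (x + h *: e) by apply: UOm => //; rewrite h00 ltW.
  rewrite -Vx !patchE !mem_set//= /m patchE mem_set//.
  move: Vx; rewrite !patchE !mem_set// => Vx.
  set a := u x in Vx *; set b := u (x + h *: e) in Vx *.
  rewrite (_ : _ - _ = (phi b - phi a - dphi a * (b - a)) * psi x); last by ring.
  rewrite normrM -[L * B * h]mulrA mulrAC -mulrA mulrA [B * h]mulrC mulrCA.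
  rewrite [leRHS](_ : _ = L * (h * line_int2 i gt h x) * B); last by ring.
  rewrite ler_pM//; apply: (le_trans (phi_taylor a b)).
  by rewrite ler_wpM2l// Vx.
have E3 : `|mV - h * J0| <= K3 * h ^+ 2.
  rewrite /mV (Rintegral_mul_line_int i ig h mm m_bnd).
  have iw := integrable_window h.
  have mJ : measurable_fun [set: measurableTypeR R]
      (fun t : measurableTypeR R => J t * window h t).
    have mm1 : measurable_fun setT (fun p : V * measurableTypeR R => m p.1).
      exact: measurableT_comp.
    have := measurable_Rfubini2 (integrable_shear e h ig mm1 (fun p => m_bnd p.1)).
    congr measurable_fun; apply/funext => t /=; rewrite /J -RintegralZr//.
    apply: (integrable_bounded_mul measurableT mm (fun x _ => m_bnd x)).
    exact: (integrable_translate (t *: e) ig).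
  have K30 : 0 <= K3 by rewrite addr_ge0// !mulr_ge0.
  have Jw t : `|J t - J0| * window h t <= K3 * h * window h t.
    have [th|th] := boolP (0 <= t <= h); last by rewrite window_out// !mulr0.
    rewrite ler_wpM2r ?window_ge0//; have /andP[t0 tlh] := th.
    apply: (@le_trans _ _ (K3 * t)); last by rewrite ler_wpM2l.
    by apply: J_dist; rewrite t0 (le_lt_trans tlh).
  have iJ : lam.-integrable setT (EFin \o (fun t => J t * window h t)).
    have iJb : lam.-integrable setT (EFin \o (fun t => (`|J0| + K3 * h) * window h t)).
      exact: eq_integrable (integrableZl measurableT (`|J0| + K3 * h) iw).
    apply: (ae_le_integrable measurableT mJ iJb).
    apply: aeW => t _; rewrite normrM (ger0_norm (window_ge0 h t)).
    have JJ : `|J t| <= `|J t - J0| + `|J0| by have := ler_normD (J t - J0) J0; rewrite subrK.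
    apply: (le_trans (ler_wpM2r (window_ge0 h t) JJ)).
    by rewrite [leRHS]mulrDl mulrDl addrC lerD2l.
  have iJ0 := integrableZl measurableT J0 iw.
  have -> : h * J0 = Rintegral lam setT (fun t => J0 * window h t).
    by rewrite RintegralZl// Rintegral_window// mulrC.
  rewrite -/(J _) -RintegralB//.
  have -> : K3 * h ^+ 2 = Rintegral lam setT (fun t => K3 * h * window h t).
    by rewrite RintegralZl// Rintegral_window//; ring.
  apply: ae_normr_Rintegral => //.
  - exact: eq_integrable (integrableB measurableT iJ iJ0).
  - exact: eq_integrable (integrableZl measurableT (K3 * h) iw).
  apply: aeW => t _; rewrite -mulrBl normrM (ger0_norm (window_ge0 h t)).
  exact: Jw.
rewrite (_ : h * _ = (Dh + h * Rintegral mu setT (fun x => pt x * partial i psi x))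
   - (Dh - mV) - (mV - h * J0)); last by ring.
rewrite (mulrDl _ K3) (mulrDl (C2 * P1)) (le_trans (ler_normB _ _))// lerD//.
by rewrite (le_trans (ler_normB _ _))// lerD.
Qed.

Lemma chain_rule_fixed :
  Rintegral mu setT (fun x => pt x * partial i psi x) = - J0.
Proof.
apply/eqP; rewrite -addr_eq0; set A := _ + J0; apply/negPn/negP => A0.
have dist := dist_h; set Q := C2 * P1 + L * B * N + K3 in dist.
have Q0 : 0 <= Q.
  rewrite !addr_ge0// !mulr_ge0//.
  by apply: Rintegral_ge0.
(* Small enough for [Q h < |A|], against [|A| h <= Q h ^ 2]; [Q + 1] guards the division when
   [Q = 0]. *)
pose h := Num.min (r / 2) (`|A| / (Q + 1) / 2).
have Q1 : 0 < Q + 1 by rewrite ltr_wpDl.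
have A1 : 0 < `|A| by rewrite normr_gt0.
have h0 : 0 < h by rewrite lt_min !divr_gt0.
have hr : h < r.
  apply: (@le_lt_trans _ _ (r / 2)); first by rewrite ge_min lexx.
  by rewrite ltr_pdivrMr// ltr_pMr// ltr1n.
have := dist h; rewrite h0 hr => /(_ isT).
rewrite normrM (gtr0_norm h0) expr2 mulrCA ler_pM2l// => AQ.
have hA : h <= `|A| / (Q + 1) / 2 by rewrite ge_min lexx orbT.
have : Q * h < `|A|.
  apply: (@le_lt_trans _ _ ((Q + 1) * h)); first by rewrite ler_wpM2r ?(ltW h0)// lerDl.
  rewrite mulrC -ltr_pdivlMr// (le_lt_trans hA)// ltr_pdivrMr// ltr_pMr ?divr_gt0//.
  by rewrite ltr1n.
by rewrite ltNge AQ.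
Qed.

End fixed_test_function.
Lemma weak_chain_rule :
  is_weak_partial Om i (phi \o u) (fun x => dphi (u x) * g x).
Proof.
move=> psi tpsi; have [_ cK KOm] := tpsi.
have [r r0 rOm] := compact_open_margin cK oOm KOm.
have r20 : 0 < r / 2 by rewrite divr_gt0.
have rOm' y : closure [set x | psi x != 0] y -> ball y (2 * (r / 2)) `<=` Om.
  by rewrite mulrCA divff// mulr1; exact: rOm.
have [B B0 HB] := test_function_bounded tpsi.
have [B' B'0 HB'] := test_function_lipschitz i tpsi.
have [C2 C20 HC2] := test_function_taylor i tpsi.
rewrite !inner_L2_restrict (chain_rule_fixed tpsi r20 rOm' B0 B'0 C20 HB HB' HC2).
congr (- _); congr Rintegral; apply/funext => x; rewrite !patchE.
by case: ifP => _; [ring|rewrite mulr0 mul0r].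
Qed.

End chain_rule.

(** * Inequalities for the Peng-Robinson energy *)

Section pointwise_derivatives.
Context {R : realType}.
Implicit Types (f g : R -> R) (x a b k : R).

Lemma is_derive_add f g x a b : is_derive x 1 f a -> is_derive x 1 g b ->
  is_derive x 1 (fun y => f y + g y) (a + b).
Proof. by move=> df dg; exact: is_deriveD. Qed.

Lemma is_derive_opp f x a : is_derive x 1 f a -> is_derive x 1 (fun y => - f y) (- a).
Proof. by move=> df; exact: is_deriveN. Qed.

Lemma is_derive_mul f g x a b : is_derive x 1 f a -> is_derive x 1 g b ->
  is_derive x 1 (fun y => f y * g y) (f x * b + g x * a).
Proof. by move=> df dg; exact: is_deriveM. Qed.

Lemma is_derive_scale k f x a : is_derive x 1 f a ->
  is_derive x 1 (fun y => k * f y) (k * a).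
Proof. by move=> df; exact: (is_deriveZ k). Qed.

Lemma is_derive_affine k b x : is_derive x 1 (fun y : R => b + k * y) k.
Proof.
have := is_derive_add (is_derive_cst b x 1) (is_derive_scale k (is_derive_id x 1)).
by rewrite add0r mulr1.
Qed.

Lemma is_derive_linear k x : is_derive x 1 (fun y : R => k * y) k.
Proof.
by have := is_derive_scale k (is_derive_id x 1); rewrite mulr1.
Qed.

Lemma is_derive_inv f x a : is_derive x 1 f a -> f x != 0 ->
  is_derive x 1 (fun y => (f y)^-1) (- a / f x ^+ 2).
Proof.
move=> df fx0; apply: (is_derive_eq (is_deriveV fx0 df)).
by rewrite /GRing.scale/= mulNr mulrC mulNr.
Qed.

Lemma is_derive_ln f x a : is_derive x 1 f a -> 0 < f x ->
  is_derive x 1 (fun y => ln (f y)) (a / f x).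
Proof.
move=> df fx0; rewrite mulrC; have dl := is_derive1_ln fx0.
exact: is_derive1_comp.
Qed.

Lemma is_derive_sqrt f x a : is_derive x 1 f a -> 0 < f x ->
  is_derive x 1 (fun y => Num.sqrt (f y)) (a / (2 * Num.sqrt (f x))).
Proof.
move=> df fx0; rewrite mulrC; have dl := is_derive1_sqrt fx0.
exact: is_derive1_comp.
Qed.

Lemma is_derive_continuous f x a : is_derive x 1 f a -> {for x, continuous f}.
Proof.
by case=> df _; apply: differentiable_continuous; apply/derivable1_diffP.
Qed.

Variables (l u : R).

Lemma is_derive_segment_mvt f f' a b :
  (forall c, l <= c <= u -> is_derive c 1 f (f' c)) ->
  l <= a -> b <= u -> a <= b ->
  exists2 c, a <= c <= b & f b - f a = f' c * (b - a).
Proof.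
move=> df la bu ab.
have sub c : a <= c <= b -> l <= c <= u.
  by move=> /andP[ac cb]; rewrite (le_trans la)//= (le_trans cb).
have [||c cab ->] := @MVT_segment R f f' a b ab.
- by move=> c; rewrite in_itv/= => /andP[/ltW ac /ltW cb]; apply/df/sub/andP.
- apply: continuous_in_subspaceT => c; rewrite inE/= in_itv/= => cab.
  exact: is_derive_continuous (df c (sub c cab)).
- by exists c => //; rewrite in_itv/= in cab.
Qed.

Lemma is_derive_antitone f f' :
  (forall c, l <= c <= u -> is_derive c 1 f (f' c)) ->
  (forall c, l <= c <= u -> f' c <= 0) ->
  forall a b, l <= a -> a <= b -> b <= u -> f b <= f a.
Proof.
move=> df f'0 a b la ab bu.
have [c /andP[ac cb] E] := is_derive_segment_mvt df la bu ab.
rewrite -subr_le0 E mulr_le0_ge0 ?subr_ge0//.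
by rewrite f'0// (le_trans la)//= (le_trans cb).
Qed.

Lemma antitone_derive_tangent f f' :
  (forall c, l <= c <= u -> is_derive c 1 f (f' c)) ->
  (forall a b, l <= a -> a <= b -> b <= u -> f' b <= f' a) ->
  forall a b, l <= a <= u -> l <= b <= u -> f b <= f a + f' a * (b - a).
Proof.
move=> df anti a b /andP[la au] /andP[lb bu]; rewrite -lerBlDl.
have [ab|/ltW ba] := leP a b.
  have [c /andP[ac cb] ->] := is_derive_segment_mvt df la bu ab.
  by rewrite ler_wpM2r ?subr_ge0// anti// (le_trans cb).
have [c /andP[bc ca] E] := is_derive_segment_mvt df lb au ba.
rewrite -opprB E -mulrN opprB ler_wnM2r ?subr_le0//.
by rewrite anti// (le_trans lb).
Qed.

(** The zero extension is measurable and bounded on the whole line. It can therefore be composed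
    with a representative whose values leave the segment on a null set. *)
Lemma continuous_segment_restrict f :
  (forall c, l <= c <= u -> {for c, continuous f}) ->
  measurable_fun setT (f \_ `[l, u]%classic) /\
  exists C, forall x, `|(f \_ `[l, u]%classic) x| <= C.
Proof.
move=> cf.
have cw : {within `[l, u]%classic, continuous f}.
  by apply: continuous_in_subspaceT => c; rewrite inE/= in_itv/=; exact: cf.
split.
  apply/(measurable_restrictT _ _).1 => //.
  by apply: subspace_continuous_measurable_fun.
have [M [_ HM]] := compact_bounded (continuous_compact cw (@segment_compact _ l u)).
exists (`|M| + 1) => x; rewrite patchE; case: ifPn => [/set_mem xlu|_]; last first.
  by rewrite normr0 addr_ge0.
apply: HM; last by exists x.
by rewrite (le_lt_trans (ler_norm _))// ltrDl.
Qed.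

End pointwise_derivatives.

(** * Concavity and tangent inequalities for the energy density *)

Section peng_robinson_inequalities.
Context {R : realType}.
Variables (theta0 Rg Te alpha beta lambda eps0 cm cM : R).
Hypotheses (Rg_gt0 : 0 < Rg) (Te_gt0 : 0 < Te) (alpha_ge0 : 0 <= alpha)
  (beta_gt0 : 0 < beta) (cm_gt0 : 0 < cm)
  (cM_eps : beta * cM <= eps0) (eps_lt1 : eps0 < 1) (lambda_gt0 : 0 < lambda)
  (lambda_ge : eps0 / (1 - eps0) ^+ 2
    + Num.sqrt (eps0 ^+ 2 / (1 - eps0) ^+ 4
                - 2 * ln (1 - eps0) * (eps0 / (1 - eps0) ^+ 2)) <= lambda).

Let RT_ge0 : 0 <= Rg * Te. Proof. by rewrite ltW// mulr_gt0. Qed.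

Let c_gt0 c : cm <= c <= cM -> 0 < c.
Proof. by move=> /andP[/(lt_le_trans cm_gt0)]. Qed.

Let bc_gt0 c : cm <= c <= cM -> 0 < beta * c.
Proof. by move=> /c_gt0 c0; rewrite mulr_gt0. Qed.

Let bc_le c : cm <= c <= cM -> beta * c <= eps0.
Proof. by move=> /andP[_ ccM]; rewrite (le_trans _ cM_eps)// ler_pM2l. Qed.

Let bc_lt1 c : cm <= c <= cM -> 0 < 1 - beta * c.
Proof. by move=> hc; rewrite subr_gt0 (le_lt_trans (bc_le hc)). Qed.

(** Write [E = eps0 / (1 - eps0) ^ 2]. Since [y / (1 - y) ^ 2] increases with [y], it is at most [E]
    for [y = beta c]; since [ln (1 - eps0) <= 0], the square root in the hypothesis is at least [E].
    Hence [lambda >= 2 E]. *)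
Let lambda_bound c : cm <= c <= cM ->
  2 * (beta * c / (1 - beta * c) ^+ 2) <= lambda.
Proof.
move=> hc; have y0 := bc_gt0 hc; have y1 := bc_lt1 hc; have ye := bc_le hc.
have e0 : 0 < eps0 by exact: lt_le_trans ye.
have e1 : 0 < 1 - eps0 by rewrite subr_gt0.
have E0 : 0 <= eps0 / (1 - eps0) ^+ 2 by rewrite divr_ge0 ?sqr_ge0 ?ltW.
have le1 : beta * c / (1 - beta * c) ^+ 2 <= eps0 / (1 - eps0) ^+ 2.
  rewrite ler_pM ?invr_ge0 ?sqr_ge0// ?(ltW y0)//.
  rewrite lef_pV2 ?posrE ?exprn_gt0// lerXn2r ?nnegrE ?(ltW e1) ?(ltW y1)//.
  by rewrite lerD2l lerN2.
apply: le_trans lambda_ge; rewrite mulr_natl mulr2n lerD//.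
apply: (le_trans le1); rewrite -[leLHS]ger0_norm// -sqrtr_sqr ler_wsqrtr//.
rewrite (_ : (eps0 / _) ^+ 2 = eps0 ^+ 2 / (1 - eps0) ^+ 4); last first.
  by field; rewrite gt_eqF.
rewrite lerDl oppr_ge0 mulr_le0_ge0// mulr_ge0_le0// ln_le0//.
by rewrite gerDl oppr_le0 ltW.
Qed.

Let g c := lambda * c - c * ln (1 - beta * c).
Let g' c := lambda - ln (1 - beta * c) + beta * c / (1 - beta * c).
Let g'' c := beta / (1 - beta * c) + beta / (1 - beta * c) ^+ 2.

Let is_derive_log c : cm <= c <= cM ->
  is_derive c 1 (fun y => ln (1 - beta * y)) (- beta / (1 - beta * c)).
Proof.
move=> hc; apply: is_derive_ln; last exact: bc_lt1.
rewrite (_ : (fun y => 1 - beta * y) = (fun y => 1 + (- beta) * y)).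
  exact: is_derive_affine.
by apply/funext => y; rewrite mulNr.
Qed.

Let is_derive_g c : cm <= c <= cM -> is_derive c 1 g (g' c).
Proof.
move=> hc.
apply: (is_derive_eq (is_derive_add (is_derive_linear lambda c)
  (is_derive_opp (is_derive_mul (is_derive_id c 1) (is_derive_log hc))))).
by rewrite /g'; field; rewrite gt_eqF// bc_lt1.
Qed.

Let is_derive_g' c : cm <= c <= cM -> is_derive c 1 g' (g'' c).
Proof.
move=> hc; have y1 := bc_lt1 hc.
have d1 : is_derive c 1 (fun y => 1 - beta * y) (- beta).
  rewrite (_ : (fun y => 1 - beta * y) = (fun y => 1 + (- beta) * y)).
    exact: is_derive_affine.
  by apply/funext => y; rewrite mulNr.
have y0 : 1 - beta * c != 0 by rewrite gt_eqF.
apply: (is_derive_eq (is_derive_add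
  (is_derive_add (is_derive_cst lambda c 1) (is_derive_opp (is_derive_log hc)))
  (is_derive_mul (is_derive_linear beta c) (is_derive_inv d1 y0)))).
by rewrite /g''; field; rewrite gt_eqF.
Qed.

Let Lam_gt0 c : cm <= c <= cM -> lambda <= lambda - ln (1 - beta * c).
Proof.
by move=> hc; rewrite lerDl oppr_ge0 ln_le0// gerDl oppr_le0 ltW// bc_gt0.
Qed.

Let g_gt0 c : cm <= c <= cM -> 0 < g c.
Proof.
move=> hc; rewrite /g (_ : _ - _ = c * (lambda - ln (1 - beta * c))); last by ring.
by rewrite mulr_gt0 ?(c_gt0 hc)//; apply: (lt_le_trans lambda_gt0); exact: Lam_gt0.
Qed.

Let g'_gt0 c : cm <= c <= cM -> 0 < g' c.
Proof.
move=> hc; apply: (lt_le_trans lambda_gt0); apply: (le_trans (Lam_gt0 hc)).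
by rewrite lerDl divr_ge0// ltW// ?bc_gt0 ?bc_lt1.
Qed.

Let G' c := g' c / (2 * Num.sqrt (g c)).

Let is_derive_G c : cm <= c <= cM -> is_derive c 1 (G_fun beta lambda) (G' c).
Proof. by move=> hc; apply: is_derive_sqrt; [exact: is_derive_g|exact: g_gt0]. Qed.

Let derive_G c : cm <= c <= cM -> derive1 (G_fun beta lambda) c = G' c.
Proof. by move=> hc; rewrite derive1E; have [_ ->] := is_derive_G hc. Qed.

Let G'_ge0 c : cm <= c <= cM -> 0 <= G' c.
Proof. by move=> hc; rewrite divr_ge0 ?mulr_ge0 ?sqrtr_ge0// ltW// g'_gt0. Qed.

(** As [G'] is nonnegative, its monotonicity can be read off its square, from which the root has
    disappeared. *)
Let G'_sqr c : cm <= c <= cM -> G' c ^+ 2 = g' c ^+ 2 / g c / 4.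
Proof.
move=> hc; have g0 := g_gt0 hc.
have s0 : Num.sqrt (g c) != 0 by rewrite gt_eqF// sqrtr_gt0.
rewrite /G' -[in RHS](sqr_sqrtr (ltW g0)); field; exact: s0.
Qed.

(* With [y = beta c] and [Lam = lambda - ln (1 - y)] one has
   [g' ^ 2 - 2 g g'' = Lam ^ 2 - 2 Lam y / (1 - y) ^ 2 + y ^ 2 / (1 - y) ^ 2],
   which is where the lower bound on [lambda] enters. *)
Let G'_antitone a b : cm <= a -> a <= b -> b <= cM -> G' b <= G' a.
Proof.
move=> ma ab bM.
have ha : cm <= a <= cM by rewrite ma (le_trans ab).
have hb : cm <= b <= cM by rewrite bM andbT (le_trans ma).
rewrite -(@ler_pXn2r _ 2)// ?nnegrE ?G'_ge0// !G'_sqr//.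
rewrite ler_pM2r ?invr_gt0//.
apply: (@is_derive_antitone _ cm cM (fun c => g' c ^+ 2 / g c)
  (fun c => - (g' c * (g' c ^+ 2 - 2 * g c * g'' c) / g c ^+ 2))) => // c hc.
- have g0 := g_gt0 hc.
  have e : (fun c => g' c ^+ 2 / g c) = (fun c => (g' c * g' c) * (g c)^-1).
    by apply/funext => y; rewrite expr2.
  have gn0 : g c != 0 by rewrite gt_eqF.
  have dg' := is_derive_g' hc.
  rewrite e; apply: (is_derive_eq (is_derive_mul (is_derive_mul dg' dg')
    (is_derive_inv (is_derive_g hc) gn0))).
  by field; rewrite gt_eqF.
- rewrite oppr_le0 divr_ge0 ?sqr_ge0// mulr_ge0 ?(ltW (g'_gt0 hc))//.
  have y1 := bc_lt1 hc.
  pose Lam := lambda - ln (1 - beta * c).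
  pose z := beta * c / (1 - beta * c) ^+ 2.
  have -> : g' c ^+ 2 - 2 * g c * g'' c =
      Lam * (Lam - 2 * z) + (beta * c / (1 - beta * c)) ^+ 2.
    by rewrite /g' /g /g'' /Lam /z; field; rewrite gt_eqF.
  have Lam0 : lambda <= Lam by exact: Lam_gt0.
  apply: addr_ge0; last exact: sqr_ge0.
  apply: mulr_ge0; first exact: le_trans (ltW lambda_gt0) Lam0.
  rewrite subr_ge0; exact: le_trans (lambda_bound hc) Lam0.
Qed.

Let G_tangent a b : cm <= a <= cM -> cm <= b <= cM ->
  G_fun beta lambda b <= G_fun beta lambda a + G' a * (b - a).
Proof. exact: (antitone_derive_tangent is_derive_G G'_antitone). Qed.

Let den c := 1 + 2 * beta * c - (beta * c) ^+ 2.

Let num_log c := 1 + (1 - Num.sqrt 2) * beta * c.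
Let den_log c := 1 + (1 + Num.sqrt 2) * beta * c.

Let sqrt2_sqr : Num.sqrt 2 ^+ 2 = 2 :> R.
Proof. by rewrite sqr_sqrtr. Qed.

Let num_log_gt0 c : cm <= c <= cM -> 0 < num_log c.
Proof.
move=> hc; have y0 := bc_gt0 hc; have y1 := bc_lt1 hc.
have s0 : 0 <= Num.sqrt 2 :> R by rewrite sqrtr_ge0.
(* [sqrt 2 < 2] makes the coefficient [1 - sqrt 2] larger than -1, so the value exceeds
   [1 - beta c > 0]. *)
have s2 := sqrt2_sqr; have : Num.sqrt 2 < 2 :> R by nra.
move=> s3; rewrite /num_log -mulrA; nra.
Qed.

Let den_log_gt0 c : cm <= c <= cM -> 0 < den_log c.
Proof.
move=> hc; have y0 := bc_gt0 hc.
have s0 : 0 <= Num.sqrt 2 :> R by rewrite sqrtr_ge0.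
by rewrite /den_log -mulrA ltr_pwDl// mulr_ge0 ?addr_ge0// ltW.
Qed.

(** This factorization identifies the denominator of [mu_attraction] with the product of the two
    arguments of the logarithm, so the derivative of [pr_log] is a single fraction over [den]. *)
Let den_fact c : den c = num_log c * den_log c.
Proof.
have s2 := sqrt2_sqr; rewrite /den /num_log /den_log.
transitivity (1 + 2 * beta * c + (1 - Num.sqrt 2 ^+ 2) * (beta * c) ^+ 2).
  by rewrite s2; ring.
by ring.
Qed.

Let den_gt0 c : cm <= c <= cM -> 0 < den c.
Proof. by move=> hc; rewrite den_fact mulr_gt0 ?num_log_gt0 ?den_log_gt0. Qed.

Let is_derive_pr_log c : cm <= c <= cM ->
  is_derive c 1 (pr_log beta) (- 2 * Num.sqrt 2 * beta / den c).
Proof.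
move=> hc; have n0 := num_log_gt0 hc; have d0 := den_log_gt0 hc.
have dn : is_derive c 1 num_log ((1 - Num.sqrt 2) * beta) by exact: is_derive_affine.
have dd : is_derive c 1 den_log ((1 + Num.sqrt 2) * beta) by exact: is_derive_affine.
have dn0 : den_log c != 0 by rewrite gt_eqF.
have q0 : 0 < num_log c / den_log c by rewrite divr_gt0.
apply: (is_derive_eq (is_derive_ln (is_derive_mul dn (is_derive_inv dd dn0)) q0)).
rewrite den_fact /num_log /den_log; field.
by rewrite !gt_eqF.
Qed.

Let sqrt2_gt0 : 0 < Num.sqrt 2 :> R. Proof. by rewrite sqrtr_gt0. Qed.

Let A c := alpha * c / (2 * Num.sqrt 2 * beta) * pr_log beta c.

Let is_derive_A c : cm <= c <= cM -> is_derive c 1 A (mu_attraction alpha beta c).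
Proof.
move=> hc; have d0 := den_gt0 hc.
have e : A = (fun c => (alpha / (2 * Num.sqrt 2 * beta)) * (c * pr_log beta c)).
  by apply/funext => y; rewrite /A; ring.
rewrite e; apply: (is_derive_eq (is_derive_scale _
  (is_derive_mul (is_derive_id c 1) (is_derive_pr_log hc)))).
rewrite /mu_attraction -/(den c); field.
by rewrite !gt_eqF.
Qed.

(** The closed form follows from [2 den - c den' = 2 + 2 beta c]. Its sign, for [alpha >= 0], is the
    concavity of the attraction energy. *)
Let mu_attraction' c := - (alpha * (2 + 2 * (beta * c)) / den c ^+ 2).

Let is_derive_mu_attraction c : cm <= c <= cM ->
  is_derive c 1 (mu_attraction alpha beta) (mu_attraction' c).
Proof.
move=> hc; have d0 := den_gt0 hc.
have dd : is_derive c 1 den (2 * beta - 2 * beta * (beta * c)).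
  have e : den = (fun c => (1 + (2 * beta) * c) - beta ^+ 2 * (c * c)).
    by apply/funext => y; rewrite /den; ring.
  rewrite e; apply: (is_derive_eq (is_derive_add (is_derive_affine (2 * beta) 1 c)
    (is_derive_opp (is_derive_scale (beta ^+ 2)
      (is_derive_mul (is_derive_id c 1) (is_derive_id c 1)))))).
  by ring.
have dn0 : den c != 0 by rewrite gt_eqF.
apply: (is_derive_eq (is_derive_add
  (is_derive_scale (alpha / (2 * Num.sqrt 2 * beta)) (is_derive_pr_log hc))
  (is_derive_opp (is_derive_mul (is_derive_linear alpha c) (is_derive_inv dd dn0))))).
rewrite /mu_attraction' /den in d0 *; field.
by rewrite !gt_eqF.
Qed.

Let mu_attraction_antitone a b : cm <= a -> a <= b -> b <= cM ->
  mu_attraction alpha beta b <= mu_attraction alpha beta a.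
Proof.
apply: (is_derive_antitone is_derive_mu_attraction) => c hc.
by rewrite oppr_le0 divr_ge0 ?sqr_ge0// mulr_ge0// addr_ge0// mulr_ge0// ltW// bc_gt0.
Qed.

Lemma f_b_tangent a b : cm <= a <= cM -> cm <= b <= cM ->
  f_b theta0 Rg Te alpha beta b - f_b theta0 Rg Te alpha beta a <=
  (nu Rg Te beta lambda a * b - s_r theta0 Rg Te alpha beta lambda a) * (b - a).
Proof.
move=> ha hb.
have At : A b - A a <= mu_attraction alpha beta a * (b - a).
  by rewrite lerBlDl; exact: (antitone_derive_tangent is_derive_A mu_attraction_antitone).
have a0 := c_gt0 ha; have b0 := c_gt0 hb.
(* With [r = b / a], the left side is [ln a (b - a) + b ln r], and
   [b ln r <= b (r - 1) = r (b - a)]. *)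
have lnt : b * ln b - a * ln a <= (ln a + b / a) * (b - a).
  have -> : b = a * (b / a) by field; rewrite gt_eqF.
  have r0 : 0 < b / a by rewrite divr_gt0.
  set r := b / a in r0 *.
  have lnr : ln r <= r - 1.
    by have := @le_ln1Dx R (r - 1); rewrite addrCA subrr addr0; apply; rewrite ltrBrDl subrr.
  have -> : a * r / a = r by field; rewrite gt_eqF.
  rewrite lnM ?posrE//.
  have -> : a * r * (ln a + ln r) - a * ln a = ln a * (a * r - a) + a * r * ln r by ring.
  rewrite mulrDl lerD2l (_ : r * _ = a * r * (r - 1)); last by ring.
  by rewrite ler_pM2l// mulr_gt0.
have G_sqr c : cm <= c <= cM -> G_fun beta lambda c ^+ 2 = g c.
  by move=> hc; rewrite sqr_sqrtr// ltW// g_gt0.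
(* The tangent inequality for the concave [G] may be squared because its left side [G b] is
   nonnegative. *)
have Gt : g b - g a <= G' a ^+ 2 * (b - a) ^+ 2 + 2 * G_fun beta lambda a * G' a * (b - a).
  have := G_tangent ha hb.
  have Gb0 : 0 <= G_fun beta lambda b by rewrite sqrtr_ge0.
  move=> H; have := ler_pM Gb0 Gb0 H H.
  rewrite -!expr2 G_sqr// sqrrD G_sqr// => H2.
  rewrite lerBlDl (le_trans H2)// le_eqVlt; apply/orP; left; apply/eqP; ring.
rewrite /f_b /nu /s_r derive_G//.
have -> : b * theta0 + Rg * Te * b * ln b - Rg * Te * b * ln (1 - beta * b) +
    alpha * b / (2 * Num.sqrt 2 * beta) * pr_log beta b -
  (a * theta0 + Rg * Te * a * ln a - Rg * Te * a * ln (1 - beta * a) +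
    alpha * a / (2 * Num.sqrt 2 * beta) * pr_log beta a) =
  theta0 * (b - a) + Rg * Te * (b * ln b - a * ln a) +
  Rg * Te * (g b - g a - lambda * (b - a)) + (A b - A a).
  by rewrite /g /A; ring.
have -> : (Rg * Te * (a^-1 + G' a ^+ 2) * b -
   (- theta0 - Rg * Te * ln a +
    Rg * Te * (G' a ^+ 2 * a - 2 * G_fun beta lambda a * G' a + lambda) -
    mu_attraction alpha beta a)) * (b - a) =
  theta0 * (b - a) + Rg * Te * ((ln a + b / a) * (b - a)) +
  Rg * Te * (G' a ^+ 2 * (b - a) ^+ 2 + 2 * G_fun beta lambda a * G' a * (b - a)
    - lambda * (b - a)) + mu_attraction alpha beta a * (b - a).
  by ring.
apply: lerD => //; apply: lerD.
  by rewrite lerD2l ler_wpM2l.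
by rewrite ler_wpM2l// lerD2r.
Qed.

Lemma nu_ge0 c : 0 < c -> 0 <= nu Rg Te beta lambda c.
Proof. by move=> c0; rewrite mulr_ge0// addr_ge0 ?sqr_ge0// invr_ge0 ltW. Qed.

Let derivable_G' c : cm <= c <= cM -> exists a, is_derive c 1 G' a.
Proof.
move=> hc; have s0 : 0 < Num.sqrt (g c) by rewrite sqrtr_gt0 g_gt0.
have ds := is_derive_scale 2 (is_derive_sqrt (is_derive_g hc) (g_gt0 hc)).
have s20 : 2 * Num.sqrt (g c) != 0 by rewrite gt_eqF// mulr_gt0.
by eexists; exact: is_derive_mul (is_derive_g' hc) (is_derive_inv ds s20).
Qed.

Local Notation D := `[cm, cM]%classic.

Lemma bounded_f_b : measurable_fun setT (f_b theta0 Rg Te alpha beta \_ D) /\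
  exists C, forall x, `|(f_b theta0 Rg Te alpha beta \_ D) x| <= C.
Proof.
apply: continuous_segment_restrict => c hc; have c0 := c_gt0 hc.
have dl := is_derive_ln (is_derive_id c 1) c0.
have d1 := is_derive_scale theta0 (is_derive_id c 1).
have d2 := is_derive_scale (Rg * Te) (is_derive_mul (is_derive_id c 1) dl).
have d3 := is_derive_scale (Rg * Te) (is_derive_mul (is_derive_id c 1) (is_derive_log hc)).
have d4 := is_derive_add (is_derive_add (is_derive_add d1 d2) (is_derive_opp d3))
  (is_derive_A hc).
have -> : f_b theta0 Rg Te alpha beta = (fun y => theta0 * y + Rg * Te * (y * ln y)
    + - (Rg * Te * (y * ln (1 - beta * y))) + A y).
  by apply/funext => y; rewrite /f_b /A; ring.
exact: is_derive_continuous d4.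
Qed.

Lemma bounded_nu : measurable_fun setT (nu Rg Te beta lambda \_ D) /\
  exists C, forall x, `|(nu Rg Te beta lambda \_ D) x| <= C.
Proof.
have -> : nu Rg Te beta lambda \_ D =
    (fun c => Rg * Te * (c^-1 + G' c * G' c)) \_ D.
  apply/funext => c; rewrite !patchE; case: ifPn => // /set_mem /=.
  by rewrite in_itv/= => hc; rewrite /nu derive_G// expr2.
apply: continuous_segment_restrict => c hc; have c0 := c_gt0 hc.
have cn0 : c != 0 by rewrite gt_eqF.
have [a dG] := derivable_G' hc.
exact: is_derive_continuous (is_derive_scale (Rg * Te)
  (is_derive_add (is_derive_inv (is_derive_id c 1) cn0) (is_derive_mul dG dG))).
Qed.

Lemma bounded_s_r :
  measurable_fun setT (s_r theta0 Rg Te alpha beta lambda \_ D) /\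
  exists C, forall x, `|(s_r theta0 Rg Te alpha beta lambda \_ D) x| <= C.
Proof.
have -> : s_r theta0 Rg Te alpha beta lambda \_ D =
    (fun c => - theta0 + - (Rg * Te * ln c) + Rg * Te * (G' c * G' c * c +
       - (2 * G_fun beta lambda c * G' c) + lambda) + - mu_attraction alpha beta c) \_ D.
  apply/funext => c; rewrite !patchE; case: ifPn => // /set_mem /=.
  by rewrite in_itv/= => hc; rewrite /s_r derive_G// expr2.
apply: continuous_segment_restrict => c hc; have c0 := c_gt0 hc.
have [a dG] := derivable_G' hc.
have dl := is_derive_ln (is_derive_id c 1) c0.
have d1 := is_derive_mul (is_derive_mul dG dG) (is_derive_id c 1).
have d2 := is_derive_opp (is_derive_mul (is_derive_scale 2 (is_derive_G hc)) dG).
have d3 := is_derive_scale (Rg * Te)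
  (is_derive_add (is_derive_add d1 d2) (is_derive_cst lambda c 1)).
have d4 := is_derive_add (is_derive_cst (- theta0) c 1)
  (is_derive_opp (is_derive_scale (Rg * Te) dl)).
exact: is_derive_continuous (is_derive_add (is_derive_add d4 d3)
  (is_derive_opp (is_derive_mu_attraction hc))).
Qed.

End peng_robinson_inequalities.

(** * Testing the scheme *)

Section L2_operations.
Context {R : realType} {d : nat}.
Local Notation V := 'rV[R]_d.
Local Notation mu := (lebesgue_rV (R := R) d).
Variables (Om : set V) (oOm : open Om) (bOm : bounded_set Om).
Implicit Types (f k : V -> R).

Let mOm : measurable Om. Proof. exact: open_measurable_rV. Qed.

Lemma in_L2_integrable f : in_L2 Om f -> mu.-integrable Om (EFin \o f).
Proof. by move=> /(in_L2_restrict oOm bOm)[]. Qed.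

Lemma in_L2_mul_integrable f k : in_L2 Om f -> in_L2 Om k ->
  mu.-integrable Om (EFin \o (fun x => f x * k x)).
Proof.
move=> [mf f2] [mk k2].
have i2 : mu.-integrable Om (EFin \o (fun x => f x ^+ 2 + k x ^+ 2)).
  exact: eq_integrable (integrableD mOm f2 k2).
apply: (ae_le_integrable mOm _ i2); first exact: measurable_funM.
by apply: aeW => x _; rewrite ler_norml; apply/andP; split; nra.
Qed.

Lemma in_L2_bounded_mul (m f : V -> R) C : measurable_fun Om m ->
  (forall x, Om x -> `|m x| <= C) -> in_L2 Om f -> in_L2 Om (fun x => m x * f x).
Proof.
move=> mm mC [mf f2]; split; first exact: measurable_funM.
have mm2 : measurable_fun Om (fun x => m x ^+ 2) by exact: measurable_funX.
have mC2 x : Om x -> `|m x ^+ 2| <= C ^+ 2.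
  by move=> /mC mx; rewrite normrX lerXn2r ?nnegrE// (le_trans _ mx).
apply: eq_integrable (integrable_bounded_mul mOm mm2 mC2 f2) => // x _ /=.
by rewrite exprMn.
Qed.

Lemma in_L2B f k : in_L2 Om f -> in_L2 Om k -> in_L2 Om (fun x => f x - k x).
Proof.
move=> [mf f2] [mk k2]; split; first exact: measurable_funB.
have i2 : mu.-integrable Om (EFin \o (fun x => 2 * f x ^+ 2 + 2 * k x ^+ 2)).
  by apply: eq_integrable (integrableD mOm (integrableZl mOm 2 f2) (integrableZl mOm 2 k2)).
apply: (ae_le_integrable mOm _ i2).
  by apply: measurable_funX; exact: measurable_funB.
apply: aeW => x _; rewrite ger0_norm ?sqr_ge0//.
by have := sqr_ge0 (f x + k x); nra.
Qed.

Lemma in_L2_cst (c : R) : in_L2 Om (cst c).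
Proof.
split; first exact: measurable_cst.
apply: measurable_bounded_integrable => //; [exact: lebesgue_rV_bounded|exact: measurable_funX|].
exists (`|c ^+ 2|); split; first exact: num_real.
by move=> M M1 x _; rewrite /= ltW.
Qed.

Lemma is_weak_partialB i (u v gu gv : V -> R) :
  in_L2 Om u -> in_L2 Om v -> in_L2 Om gu -> in_L2 Om gv ->
  is_weak_partial Om i u gu -> is_weak_partial Om i v gv ->
  is_weak_partial Om i (fun x => u x - v x) (fun x => gu x - gv x).
Proof.
move=> u2 v2 gu2 gv2 wu wv phi tphi.
have split_inner f k chi : in_L2 Om f -> in_L2 Om k -> test_function Om chi ->
    inner_L2 Om (fun x => f x - k x) chi = inner_L2 Om f chi - inner_L2 Om k chi.
  move=> f2 k2 tchi; have [schi _ _] := tchi.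
  have [C _ HC] := test_function_bounded tchi.
  have mchi : measurable_fun Om chi.
    apply: measurable_funTS; apply: continuous_measurable_rV.
    exact: continuous_smooth.
  have ic h : in_L2 Om h -> mu.-integrable Om (EFin \o (fun x => h x * chi x)).
    move=> /in_L2_integrable ih.
    apply: eq_integrable (integrable_bounded_mul mOm mchi (fun x _ => HC x) ih) => //.
    by move=> x _ /=; rewrite mulrC.
  rewrite /inner_L2 -RintegralB ?ic//.
  by congr Rintegral; apply/funext => x; rewrite mulrBl.
rewrite !split_inner//; last exact: test_function_partial.
by rewrite wu// wv// opprB opprK addrC.
Qed.

Definition H1_sub (u v : H1 Om) : H1 Om := MkH1
  (in_L2B (H1_val_L2 u) (H1_val_L2 v))
  (fun i => in_L2B (H1_grad_L2 u i) (H1_grad_L2 v i))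
  (fun i => is_weak_partialB (H1_val_L2 u) (H1_val_L2 v)
     (H1_grad_L2 u i) (H1_grad_L2 v i) (H1_gradP u i) (H1_gradP v i)).

Lemma integrable_grad (u v : H1 Om) : mu.-integrable Om
  (EFin \o (fun x => \sum_(i < d) (H1_grad u i x * H1_grad v i x))).
Proof.
rewrite (_ : _ \o _ = (fun x : V => (\sum_(i < d)
    (H1_grad u i x * H1_grad v i x)%R%:E)%E)).
  apply: (integrable_sum mOm) => i _.
  exact: in_L2_mul_integrable (H1_grad_L2 u i) (H1_grad_L2 v i).
by apply/funext => x /=; rewrite -sumEFin.
Qed.

(** Pointwise [p (p - q) - (p ^ 2 - q ^ 2) / 2 = (p - q) ^ 2 / 2 >= 0], the gain of treating the
    gradient term implicitly. *)
Lemma inner_grad_sub_ge (u v : H1 Om) :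
  (inner_grad u u - inner_grad v v) / 2 <= inner_grad u (H1_sub u v).
Proof.
rewrite /inner_grad -RintegralB//; [|exact: integrable_grad|exact: integrable_grad].
have iB : mu.-integrable Om (EFin \o (fun x =>
    \sum_(i < d) (H1_grad u i x * H1_grad u i x) -
    \sum_(i < d) (H1_grad v i x * H1_grad v i x))).
  exact: eq_integrable (integrableB mOm (integrable_grad u u) (integrable_grad v v)).
rewrite -RintegralZr//; apply: le_Rintegral => //.
- exact: eq_integrable (integrableZr mOm 2^-1 iB).
- exact: integrable_grad.
move=> x _; rewrite -sumrB mulr_suml; apply: ler_sum => i _ /=.
by rewrite ler_pdivrMr//; have := sqr_ge0 (H1_grad u i x - H1_grad v i x); nra.
Qed.

Section composition.
Variables (phi dphi : R -> R) (L C K : R) (u : H1 Om).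
Hypotheses (mphi : measurable_fun setT phi) (mdphi : measurable_fun setT dphi)
  (L0 : 0 <= L) (C0 : 0 <= C)
  (phi_taylor : forall a b, `|phi b - phi a - dphi a * (b - a)| <= L * (b - a) ^+ 2)
  (dphi_lip : forall a b, `|dphi b - dphi a| <= L * `|b - a|)
  (dphi_bnd : forall a, `|dphi a| <= C)
  (phi_growth : forall a, `|phi a| <= `|a - K|).

(** Constants are square integrable on the bounded set [Om], hence so is [u - K], which dominates
    [phi (u)]. *)
Let phi_L2 : in_L2 Om (phi \o u).
Proof.
have [mu_ u2] := H1_val_L2 u.
have [_ uK2] := in_L2B (H1_val_L2 u) (in_L2_cst K).
have mpu : measurable_fun Om (phi \o u) by exact: (measurableT_comp mphi).
split => //; apply: (ae_le_integrable mOm _ uK2); first exact: measurable_funX.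
apply: aeW => x _ /=; rewrite ger0_norm ?sqr_ge0//.
by rewrite -[leLHS]real_normK ?num_real// -[leRHS]real_normK ?num_real// lerXn2r ?nnegrE.
Qed.

Let dphi_L2 i : in_L2 Om (fun x => dphi (u x) * H1_grad u i x).
Proof.
have [mu_ _] := H1_val_L2 u.
apply: (in_L2_bounded_mul _ (fun x _ => dphi_bnd (u x)) (H1_grad_L2 u i)).
exact: (measurableT_comp mdphi).
Qed.

Definition H1_comp : H1 Om := MkH1 phi_L2 dphi_L2
  (fun i => weak_chain_rule oOm bOm (H1_val_L2 u) (H1_grad_L2 u i)
     (H1_gradP u i) mdphi L0 C0 phi_taylor dphi_lip dphi_bnd phi_L2).

Lemma inner_grad_comp_ge0 : (forall a, 0 <= dphi a) -> 0 <= inner_grad u H1_comp.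
Proof.
move=> dphi0; apply: Rintegral_ge0 => x _; apply: sumr_ge0 => i _ /=.
by rewrite mulrCA mulr_ge0// -expr2 sqr_ge0.
Qed.

End composition.
End L2_operations.

(** * A smoothed positive part *)

Section huber.
Context {R : realType}.
Implicit Types (s a b : R).

(* A C^1 substitute for the positive part: its derivative is bounded and
   Lipschitz, which is all that the chain rule asks for. *)
Definition dhuber s : R := Num.min (Num.max s 0) 1.
Definition huber s : R := dhuber s ^+ 2 / 2 + (Num.max s 0 - dhuber s).

Lemma huberP s : [\/ [/\ s <= 0, huber s = 0 & dhuber s = 0],
  [/\ 0 < s, s <= 1, huber s = s ^+ 2 / 2 & dhuber s = s] |
  [/\ 1 < s, huber s = s - 2^-1 & dhuber s = 1]].
Proof.
rewrite /huber /dhuber; have [s0|s0] := leP s 0.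
  by constructor 1; split=> //; rewrite ?min_l// expr0n/= mul0r subrr addr0.
have [s1|s1] := leP s 1.
  by constructor 2; split=> //; rewrite subrr addr0.
by constructor 3; split=> //; rewrite expr1n; field.
Qed.

Lemma measurable_dhuber : measurable_fun setT dhuber.
Proof. by apply: measurable_minr => //; exact: measurable_maxr. Qed.

Lemma measurable_huber : measurable_fun setT huber.
Proof.
apply: measurable_funD.
  by apply: measurable_funM => //; apply: measurable_funX; exact: measurable_dhuber.
by apply: measurable_funB; [exact: measurable_maxr|exact: measurable_dhuber].
Qed.

Lemma dhuber_ge0 s : 0 <= dhuber s.
Proof. by case: (huberP s) => -[*]; lra. Qed.

Lemma dhuber_bnd s : `|dhuber s| <= 1.
Proof. by rewrite ger0_norm ?dhuber_ge0//; case: (huberP s) => -[*]; lra. Qed.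

Lemma huber_le0 s : s <= 0 -> huber s = 0.
Proof. by move=> s0; case: (huberP s) => -[*]; lra. Qed.

Lemma huber_gt0 s : 0 < s -> 0 < huber s.
Proof. by move=> s0; case: (huberP s) => -[*]; nra. Qed.

Lemma huber_growth s : `|huber s| <= `|s|.
Proof.
case: (huberP s) => -[]; first by move=> _ ->; rewrite normr0.
  by move=> s0 s1 -> _; rewrite !ger0_norm; nra.
by move=> s1 -> _; rewrite !ger0_norm; lra.
Qed.

Lemma dhuber_lip a b : `|dhuber b - dhuber a| <= 1 * `|b - a|.
Proof.
have h1 := ler_norm (b - a); have h2 := ler_norm (- (b - a)).
rewrite normrN in h2.
by rewrite mul1r; case: (huberP a) => -[*]; case: (huberP b) => -[*];
  rewrite ler_norml; apply/andP; split; lra.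
Qed.

Lemma huber_taylor a b :
  `|huber b - huber a - dhuber a * (b - a)| <= 1 * (b - a) ^+ 2.
Proof.
have ab := sqr_ge0 (b - a).
rewrite mul1r; case: (huberP a) => -[]; case: (huberP b) => -[].
1: move=> b0 -> _ a0 -> ->.
2: move=> b0 b1 -> _ a0 -> ->.
3: move=> b1 -> _ a0 -> ->.
4: move=> b0 -> _ a0 a1 -> ->.
5: move=> b0 b1 -> _ a0 a1 -> ->.
6: move=> b1 -> _ a0 a1 -> ->.
7: move=> b0 -> _ a1 -> ->.
8: move=> b0 b1 -> _ a1 -> ->.
9: move=> b1 -> _ a1 -> ->.
all: rewrite ler_norml; apply/andP; split.
all: nra.
Qed.

End huber.

(** * The maximum principle for the scheme *)

Section scheme_tests.
Context {R : realType} {d : nat}.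
Local Notation V := 'rV[R]_d.
Local Notation mu := (lebesgue_rV (R := R) d).
Variables (Om : set V) (oOm : open Om) (bOm : bounded_set Om).
Variables (c0 c1 : H1 Om) (tau kappa ct mu_e cm cM Cn Cs : R) (nu s : R -> R).
Local Notation D := `[cm, cM]%classic.
Hypotheses (tau_gt0 : 0 < tau) (kappa_gt0 : 0 < kappa)
  (mnu : measurable_fun setT (nu \_ D)) (nuC : forall x, `|(nu \_ D) x| <= Cn)
  (ms : measurable_fun setT (s \_ D)) (sC : forall x, `|(s \_ D) x| <= Cs)
  (c0D : {ae mu, forall x, Om x -> cm <= c0 x <= cM})
  (sol : weak_solution tau kappa ct nu s c0 c1 mu_e).

Let mOm : measurable Om. Proof. exact: open_measurable_rV. Qed.

Lemma ae_restrict_comp (f : R -> R) (c : H1 Om) :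
  {ae mu, forall x, Om x -> cm <= c x <= cM} ->
  {ae mu, forall x, Om x -> f (c x) = (f \_ D) (c x)}.
Proof.
by apply: filterS => x + Ox => /(_ Ox) cx; rewrite patchE mem_set//= in_itv.
Qed.

(* [nu] and [s] need not be measurable outside [[cm, cM]], hence the
   restrictions. *)
Definition residual (x : V) : R :=
  (nu \_ D) (c0 x) * c1 x - ((s \_ D) (c0 x) + mu_e).

Let source_L2 : in_L2 Om (fun x => (s \_ D) (c0 x) + mu_e).
Proof.
have [m0 _] := H1_val_L2 c0.
have msm : measurable_fun Om (fun x => (s \_ D) (c0 x) + mu_e).
  by apply: measurable_funD => //; exact: (measurableT_comp ms m0).
have bnd x : Om x -> `|(s \_ D) (c0 x) + mu_e| <= Cs + `|mu_e|.
  by move=> _; rewrite (le_trans (ler_normD _ _))// lerD2r.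
have := in_L2_bounded_mul oOm msm bnd (in_L2_cst oOm bOm 1).
by congr (in_L2 Om _); apply/funext => x; rewrite /= mulr1.
Qed.

Let nuc1_L2 : in_L2 Om (fun x => (nu \_ D) (c0 x) * c1 x).
Proof.
have [m0 _] := H1_val_L2 c0.
apply: (in_L2_bounded_mul oOm _ (fun x _ => nuC (c0 x)) (H1_val_L2 c1)).
exact: (measurableT_comp mnu m0).
Qed.

Lemma residual_L2 : in_L2 Om residual.
Proof. exact: in_L2B. Qed.

(** [nu] and [s] are exchanged for their measurable bounded restrictions, which changes the
    integrands only on a null set; the integrals can then be split and collected in [residual]. *)
Lemma weak_formulation (w : H1 Om) :
  tau^-1 * Rintegral mu Om (fun x => (c1 x - c0 x) * w x) + kappa * inner_grad c1 w
  + Rintegral mu Om (fun x => residual x * w x) = 0.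
Proof.
have [_ /(_ w)] := sol; rewrite /inner_L2.
have -> : Rintegral mu Om (fun x => nu (c0 x) * c1 x * w x) =
    Rintegral mu Om (fun x => (nu \_ D) (c0 x) * c1 x * w x).
  apply: ae_eq_Rintegral; apply: filterS (ae_restrict_comp nu c0D) => x H Ox.
  by rewrite (H Ox).
have -> : Rintegral mu Om (fun x => (s (c0 x) + mu_e) * w x) =
    Rintegral mu Om (fun x => ((s \_ D) (c0 x) + mu_e) * w x).
  apply: ae_eq_Rintegral; apply: filterS (ae_restrict_comp s c0D) => x H Ox.
  by rewrite (H Ox).
have i1 := in_L2_mul_integrable oOm nuc1_L2 (H1_val_L2 w).
have i2 := in_L2_mul_integrable oOm source_L2 (H1_val_L2 w).
have -> : Rintegral mu Om (fun x => residual x * w x) =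
    Rintegral mu Om (fun x => (nu \_ D) (c0 x) * c1 x * w x) -
    Rintegral mu Om (fun x => ((s \_ D) (c0 x) + mu_e) * w x).
  rewrite -RintegralB//; congr Rintegral; apply/funext => x.
  by rewrite /residual mulrBl.
by move=> E; rewrite addrA E subrr.
Qed.

(** Three terms with nonnegative integrals sum to 0, so the time term has integral 0; its integrand,
    being nonnegative, vanishes almost everywhere. *)
Lemma weak_test_sign (w : H1 Om) : 0 <= inner_grad c1 w ->
  {ae mu, forall x, Om x -> 0 <= (c1 x - c0 x) * w x} ->
  {ae mu, forall x, Om x -> 0 <= residual x * w x} ->
  {ae mu, forall x, Om x -> (c1 x - c0 x) * w x = 0}.
Proof.
move=> gw dw rw.
have id : mu.-integrable Om (EFin \o (fun x => (c1 x - c0 x) * w x)).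
  exact: (in_L2_mul_integrable oOm (in_L2B oOm (H1_val_L2 c1) (H1_val_L2 c0)) (H1_val_L2 w)).
have ir := in_L2_mul_integrable oOm residual_L2 (H1_val_L2 w).
apply: Rintegral_eq0_ae => //.
have r0 : 0 <= Rintegral mu Om (fun x => residual x * w x).
  have -> : (0 : R) = Rintegral mu Om (cst 0) by rewrite /Rintegral integral0.
  apply: ae_le_Rintegral => //.
  by apply: eq_integrable (@integrable0 _ _ _ mu Om).
have k0 : 0 <= kappa * inner_grad c1 w by rewrite mulr_ge0// ltW.
have E := weak_formulation w.
have t0 : 0 < tau^-1 by rewrite invr_gt0.
by rewrite -(pmulr_rle0 _ t0); lra.
Qed.

Hypothesis nu_ge0 : forall c, cm <= c <= cM -> 0 <= nu c.

Let residual_in x : Om x -> cm <= c0 x <= cM ->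
  residual x = nu (c0 x) * c1 x - (s (c0 x) + mu_e).
Proof. by move=> Ox c0x; rewrite /residual !patchE mem_set//= in_itv. Qed.

(** Where [c1 > cM], [nu (c0) >= 0] gives [residual >= nu (c0) cM - s (c0) - mu_e >= 0], and
    [c1 - c0 > 0] as [c0 <= cM]. The test function is positive exactly there, so the vanishing of
    the time term rules this set out up to measure 0. *)
Lemma solution_le_upper : (forall c, cm <= c <= cM -> mu_e <= cM * nu c - s c) ->
  {ae mu, forall x, Om x -> c1 x <= cM}.
Proof.
move=> up.
pose phi (t : R) := huber (t - cM); pose dphi (t : R) := dhuber (t - cM).
have msub : measurable_fun setT (fun t : R => t - cM) by exact: measurable_funB.
have mphi : measurable_fun setT phi by exact: (measurableT_comp measurable_huber msub).
have mdphi : measurable_fun setT dphi by exact: (measurableT_comp measurable_dhuber msub).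
have taylor a b : `|phi b - phi a - dphi a * (b - a)| <= 1 * (b - a) ^+ 2.
  have := huber_taylor (a - cM) (b - cM).
  by rewrite (_ : b - cM - (a - cM) = b - a)//; ring.
have lip a b : `|dphi b - dphi a| <= 1 * `|b - a|.
  have := dhuber_lip (a - cM) (b - cM).
  by rewrite (_ : b - cM - (a - cM) = b - a)//; ring.
have growth a : `|phi a| <= `|a - cM| by exact: huber_growth.
pose w := H1_comp oOm bOm c1 mphi mdphi ler01 ler01 taylor lip
  (fun a => dhuber_bnd (a - cM)) growth.
have wE x : w x = huber (c1 x - cM) by [].
have gw : 0 <= inner_grad c1 w.
  by apply: inner_grad_comp_ge0 => a; exact: dhuber_ge0.
have : {ae mu, forall x, Om x -> (c1 x - c0 x) * w x = 0}.
  apply: weak_test_sign => //.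
  - apply: filterS c0D => x + Ox => /(_ Ox) /andP[_ c0M]; rewrite wE.
    have [c1M|c1M] := leP (c1 x) cM; first by rewrite huber_le0 ?mulr0// subr_le0.
    by rewrite mulr_ge0 ?ltW ?huber_gt0 ?subr_gt0// (le_lt_trans c0M).
  - apply: filterS c0D => x + Ox => /(_ Ox) c0x; rewrite wE.
    have [c1M|c1M] := leP (c1 x) cM; first by rewrite huber_le0 ?mulr0// subr_le0.
    rewrite mulr_ge0 ?(ltW (huber_gt0 _)) ?subr_gt0// residual_in//.
    have := up _ c0x; have := ler_wpM2l (nu_ge0 c0x) (ltW c1M); lra.
apply: filterS2 c0D => x + + Ox => /(_ Ox) /andP[_ c0M] /(_ Ox); rewrite wE.
have [//|c1M] := leP (c1 x) cM; move=> /eqP; rewrite mulf_eq0 => /orP[/eqP E|/eqP E].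
  by move: c0M; rewrite -[c0 x]addr0 -E addrCA subrr addr0 leNgt c1M.
by have := @huber_gt0 R (c1 x - cM); rewrite E ltxx subr_gt0 => /(_ c1M).
Qed.

Lemma solution_ge_lower : (forall c, cm <= c <= cM -> cm * nu c - s c <= mu_e) ->
  {ae mu, forall x, Om x -> cm <= c1 x}.
Proof.
move=> lo.
(* The reflection keeps [phi] nondecreasing, so the gradient term retains its sign, while the test
   function is now negative exactly where [c1 < cm]; there [c1 - c0] and the residual are
   nonpositive. *)
pose phi (t : R) := - huber (cm - t); pose dphi (t : R) := dhuber (cm - t).
have msub : measurable_fun setT (fun t : R => cm - t) by exact: measurable_funB.
have mphi : measurable_fun setT phi.
  by apply: measurableT_comp => //; exact: (measurableT_comp measurable_huber msub).
have mdphi : measurable_fun setT dphi by exact: (measurableT_comp measurable_dhuber msub).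
have taylor a b : `|phi b - phi a - dphi a * (b - a)| <= 1 * (b - a) ^+ 2.
  have := huber_taylor (cm - a) (cm - b).
  rewrite (_ : cm - b - (cm - a) = - (b - a)); last by ring.
  by rewrite sqrrN -normrN; congr (`|_| <= _); rewrite /phi /dphi; ring.
have lip a b : `|dphi b - dphi a| <= 1 * `|b - a|.
  have := dhuber_lip (cm - a) (cm - b).
  by rewrite (_ : cm - b - (cm - a) = - (b - a)) ?normrN//; ring.
have growth a : `|phi a| <= `|a - cm|.
  by rewrite normrN distrC; exact: huber_growth.
pose w := H1_comp oOm bOm c1 mphi mdphi ler01 ler01 taylor lip
  (fun a => dhuber_bnd (cm - a)) growth.
have wE x : w x = - huber (cm - c1 x) by [].
have gw : 0 <= inner_grad c1 w.
  by apply: inner_grad_comp_ge0 => a; exact: dhuber_ge0.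
have : {ae mu, forall x, Om x -> (c1 x - c0 x) * w x = 0}.
  apply: weak_test_sign => //.
  - apply: filterS c0D => x + Ox => /(_ Ox) /andP[c0m _]; rewrite wE.
    have [c1m|c1m] := leP cm (c1 x).
      by rewrite huber_le0 ?oppr0 ?mulr0// subr_le0.
    rewrite mulrN -mulNr opprB mulr_ge0 ?(ltW (huber_gt0 _)) ?subr_gt0//.
    by rewrite subr_ge0 ltW// (lt_le_trans c1m).
  - apply: filterS c0D => x + Ox => /(_ Ox) c0x; rewrite wE.
    have [c1m|c1m] := leP cm (c1 x).
      by rewrite huber_le0 ?oppr0 ?mulr0// subr_le0.
    rewrite mulrN -mulNr mulr_ge0 ?(ltW (huber_gt0 _)) ?subr_gt0// residual_in//.
    have := lo _ c0x; have := ler_wpM2l (nu_ge0 c0x) (ltW c1m); lra.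
apply: filterS2 c0D => x + + Ox => /(_ Ox) /andP[c0m _] /(_ Ox); rewrite wE.
have [//|c1m] := leP cm (c1 x); move=> /eqP.
rewrite mulrN oppr_eq0 mulf_eq0 => /orP[/eqP E|/eqP E].
  by move: c0m; rewrite -[c0 x]addr0 -E addrCA subrr addr0 leNgt c1m.
by have := @huber_gt0 R (cm - c1 x); rewrite E ltxx subr_gt0 => /(_ c1m).
Qed.

End scheme_tests.

(** * Decay of the energy *)

Lemma integrable_restrict_comp {R : realType} {d : nat} (Om : set 'rV[R]_d)
    (f : R -> R) (C : R) (c : H1 Om) : open Om -> bounded_set Om ->
  measurable_fun setT f -> (forall x, `|f x| <= C) ->
  (lebesgue_rV d).-integrable Om (EFin \o (fun x => f (c x))).
Proof.
move=> oOm bOm mf fC; have mOm := open_measurable_rV oOm.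
apply: measurable_bounded_integrable => //.
- exact: lebesgue_rV_bounded.
- by have [mc _] := H1_val_L2 c; exact: (measurableT_comp mf mc).
exists C; split; first exact: num_real.
by move=> M CM x _ /=; exact: le_trans (fC _) (ltW CM).
Qed.

Lemma dec_gt0 {R : realType} (a b c : nat) : (0 < b)%N -> 0 < dec a b c :> R.
Proof.
move=> b0; rewrite /dec; apply: ltr_pwDl; last by rewrite divr_ge0// exprn_ge0.
by apply: ltr_wpDl => //; rewrite divr_gt0 ?exprn_gt0// ltr0n.
Qed.

Lemma pr_beta_gt0 {R : realType} (Rg Tc Pc : R) :
  0 < Rg -> 0 < Tc -> 0 < Pc -> 0 < pr_beta Rg Tc Pc.
Proof. by move=> *; rewrite mulr_gt0 ?dec_gt0// divr_gt0// mulr_gt0. Qed.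

Lemma pr_alpha_ge0 {R : realType} (Rg Te Tc Pc omega : R) :
  0 < Pc -> 0 <= pr_alpha Rg Te Tc Pc omega.
Proof.
move=> Pc0; rewrite mulr_ge0 ?sqr_ge0// mulr_ge0 ?(ltW (dec_gt0 _ _ _))//.
by rewrite divr_ge0 ?(ltW Pc0)// mulr_ge0 ?sqr_ge0.
Qed.

Theorem theorem4p3 (R : realType) (d : nat) (d_gt0 : (0 < d)%N)
    (Omega : set 'rV[R]_d) (Omega_dom : smooth_bounded_domain Omega)
    (kappa ct theta0 Rg Te Tc Pc omega : R)
    (kappa_gt0 : 0 < kappa) (ct_gt0 : 0 < ct)
    (Rg_gt0 : 0 < Rg) (Te_gt0 : 0 < Te) (Tc_gt0 : 0 < Tc) (Pc_gt0 : 0 < Pc)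
    (cm cM eps0 lambda : R) :
  let alpha := pr_alpha Rg Te Tc Pc omega in
  let beta := pr_beta Rg Tc Pc in
  let nu := nu Rg Te beta lambda in
  let s_r := s_r theta0 Rg Te alpha beta lambda in
  let F := free_energy (Omega := Omega) kappa (f_b theta0 Rg Te alpha beta) in
  0 < cm -> cm <= cM -> beta * cM <= eps0 -> eps0 < 1 ->
  0 < lambda ->
  lambda >= eps0 / (1 - eps0) ^+ 2
    + Num.sqrt (eps0 ^+ 2 / (1 - eps0) ^+ 4
                - 2 * ln (1 - eps0) * (eps0 / (1 - eps0) ^+ 2)) ->
  forall c0 : H1 Omega,
  {ae lebesgue_rV d, forall x, Omega x -> cm <= c0 x <= cM} ->
  \int[lebesgue_rV d]_(x in Omega) c0 x = ct ->
  forall tau : R, 0 < tau ->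
  forall (c1 : H1 Omega) (mu_e : R),
  weak_solution tau kappa ct nu s_r c0 c1 mu_e ->
  (forall c, cm <= c <= cM -> cm * nu c - s_r c <= mu_e) ->
  (forall c, cm <= c <= cM -> mu_e <= cM * nu c - s_r c) ->
  F c1 <= F c0.
Proof.
move=> alpha beta nu s_r F cm0 cmM bM e1 l0 lge c0 c0D c0ct tau tau0 c1 mu_e sol lo up.
have [_ oOm _ bOm _] := Omega_dom.
have mOm := open_measurable_rV oOm.
have beta0 : 0 < beta by exact: pr_beta_gt0.
have alpha0 : 0 <= alpha by exact: pr_alpha_ge0.
have [mnu [Cn nuC]] := bounded_nu Rg Te beta0 cm0 bM e1 l0.
have [ms [Cs sC]] := bounded_s_r theta0 Rg Te alpha beta0 cm0 bM e1 l0.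
have [mf [Cf fC]] := bounded_f_b theta0 Rg Te alpha beta0 cm0 bM e1.
have nu0 c : cm <= c <= cM -> 0 <= nu c.
  by move=> /andP[cmc _]; apply: nu_ge0 => //; exact: lt_le_trans cmc.
have c1M := solution_le_upper oOm bOm tau0 kappa_gt0 mnu nuC ms sC c0D sol nu0 up.
have c1m := solution_ge_lower oOm bOm tau0 kappa_gt0 mnu nuC ms sC c0D sol nu0 lo.
have c1D : {ae lebesgue_rV d, forall x, Omega x -> cm <= c1 x <= cM}.
  by apply: filterS2 c1m c1M => x H1 H2 Ox; rewrite H1// H2.
have := weak_formulation oOm bOm mnu nuC ms sC c0D sol (H1_sub oOm bOm c1 c0).
have := inner_grad_sub_ge oOm bOm c1 c0.
set ig := inner_grad c1 (H1_sub oOm bOm c1 c0) => igE.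
have d2 : 0 <= Rintegral (lebesgue_rV d) Omega
    (fun x => (c1 x - c0 x) * H1_sub oOm bOm c1 c0 x).
  by apply: Rintegral_ge0 => x _; rewrite -expr2 sqr_ge0.
have dL2 := in_L2B oOm (H1_val_L2 c1) (H1_val_L2 c0).
have ires := in_L2_mul_integrable oOm
  (residual_L2 oOm bOm c0 c1 mu_e mnu nuC ms sC) dL2.
have if1 := integrable_restrict_comp c1 oOm bOm mf fC.
have if0 := integrable_restrict_comp c0 oOm bOm mf fC.
have fle : Rintegral (lebesgue_rV d) Omega (fun x => f_b theta0 Rg Te alpha beta (c1 x)) -
    Rintegral (lebesgue_rV d) Omega (fun x => f_b theta0 Rg Te alpha beta (c0 x)) <=
    Rintegral (lebesgue_rV d) Omega
      (fun x => residual c0 c1 mu_e cm cM nu s_r x * (c1 x - c0 x)).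
  rewrite (ae_eq_Rintegral (ae_restrict_comp (f_b theta0 Rg Te alpha beta) c1D)).
  rewrite (ae_eq_Rintegral (ae_restrict_comp (f_b theta0 Rg Te alpha beta) c0D)).
  have i1 := in_L2_integrable oOm bOm (H1_val_L2 c1).
  have i0 := in_L2_integrable oOm bOm (H1_val_L2 c0).
  have id : (lebesgue_rV d).-integrable Omega (EFin \o (fun x => c1 x - c0 x)).
    exact: in_L2_integrable dL2.
  have mass : Rintegral (lebesgue_rV d) Omega (fun x => mu_e * (c1 x - c0 x)) = 0.
    by rewrite RintegralZl// RintegralB// c0ct sol.1 subrr mulr0.
  have imass : (lebesgue_rV d).-integrable Omega (EFin \o (fun x => mu_e * (c1 x - c0 x))).
    exact: eq_integrable (integrableZl mOm mu_e id).
  (* The residual contains [- mu_e], absent from the pointwise tangent inequality. Equal masses make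
     the integral of [mu_e (c1 - c0)] zero, so it is added to cancel that constant. *)
  rewrite -RintegralB// -[leRHS]addr0 -mass -RintegralD//.
  apply: ae_le_Rintegral => //.
  - exact: eq_integrable (integrableB mOm if1 if0).
  - exact: eq_integrable (integrableD mOm ires imass).
  apply: filterS2 c1D c0D => x H1 H0 Ox; have h1 := H1 Ox; have h0 := H0 Ox.
  rewrite /residual !patchE !mem_set ?inE/= ?in_itv//=.
  have := f_b_tangent theta0 Rg_gt0 Te_gt0 alpha0 beta0 cm0 bM e1 l0 lge h0 h1.
  rewrite -/nu -/s_r; lra.
(* By [E], the integral of the residual against [c1 - c0] plus [kappa * ig] equals minus the time
   term, which is nonpositive for every [tau > 0]; [fle] and [igE] bound the energy difference by
   that sum. *)
move=> E; rewrite /F /free_energy.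
have t0 : 0 <= tau^-1 * Rintegral (lebesgue_rV d) Omega
    (fun x => (c1 x - c0 x) * H1_sub oOm bOm c1 c0 x).
  by rewrite mulr_ge0// invr_ge0 ltW.
have kg := ler_wpM2l (ltW kappa_gt0) igE.
rewrite -/(Rintegral _ _ _) -/(Rintegral _ _ _).
change (Rintegral (lebesgue_rV d) Omega
    (fun x => residual c0 c1 mu_e cm cM nu s_r x * H1_sub oOm bOm c1 c0 x))
  with (Rintegral (lebesgue_rV d) Omega
    (fun x => residual c0 c1 mu_e cm cM nu s_r x * (c1 x - c0 x))) in E.
by lra.
Qed.
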